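(* Let $A\in\mathbb{R}^{n\times n}$ be a real symmetric matrix and let $C\in\mathbb{R}^{n\times r}$ be a column subset of $A$ with $n\ge r$ and full column rank. Let $t>r$ be an integer that is a scalar multiple of $r$ (e.g. $t=2r$), and let $0<\epsilon<1$ and $\delta\ge 0$ be such that the random matrix $G\in\mathbb{R}^{t\times n}$ with i.i.d. entries $G_{ij}\sim\mathcal{N}(0,1/t)$ is an $(\epsilon,\delta)$-oblivious $\ell_2$-subspace embedding for $n\times r$ matrices. Define $$M^*:=\operatorname*{arg\,min}_{M\in\mathbb{R}^{r\times r}}\|A-CMC^{\top}\|_F^2,\qquad \widehat{M}:=\operatorname*{arg\,min}_{M\in\mathbb{R}^{r\times r}}\|G(A-CMC^{\top})G^{\top}\|_F^2 ,$$ and $$c_1(r,t):=\left(1+\sqrt{\tfrac{r}{t}}\right)^2\left(1+\sqrt{\tfrac{2}{r}}\right)^{1/2}\left(1+\tfrac{2}{t}\right)^{1/2}.$$ Then for every $\Delta>c_1(r,t)\sqrt{r}$, setting $c_2(r,t,\epsilon):=\dfrac{\Delta}{(1-\epsilon)^2\sqrt{r}}$, the inequality $$\|A-C\widehat{M}C^{\top}\|_*\le\bigl(1+c_2(r,t,\epsilon)\sqrt{r}\bigr)\,\|A-CM^*C^{\top}\|_*$$ holds with probability at least $1-\left(\dfrac{c_1(r,t)\sqrt{r}}{\Delta}+\delta\right)$.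
   Context: A column subset of $A$ is a matrix $C=A(:,I)\in\mathbb{R}^{n\times r}$ formed by the columns of $A$ indexed by a set $I\subseteq\{1,\dots,n\}$ with $|I|=r$. $\|\cdot\|_F$ is the Frobenius norm, $\|\cdot\|_*$ the nuclear (trace) norm, $\|\cdot\|_2$ the Euclidean vector norm, and $\dagger$ the Moore–Penrose pseudoinverse. A matrix $X\in\mathbb{R}^{t\times n}$ is a $(1\pm\epsilon)$ $\ell_2$-subspace embedding for (the column space of) $B\in\mathbb{R}^{n\times r}$ if $(1-\epsilon)\|Bx\|_2^2\le\|XBx\|_2^2\le(1+\epsilon)\|Bx\|_2^2$ for all $x\in\mathbb{R}^r$. A random matrix $X\in\mathbb{R}^{t\times n}$ is an $(\epsilon,\delta)$-oblivious $\ell_2$-subspace embedding (for $n\times r$ matrices) if, for every fixed $U\in\mathbb{R}^{n\times r}$, with probability at least $1-\delta$ it is a $(1\pm\epsilon)$ $\ell_2$-subspace embedding for $U$. Explicitly, $M^*=C^{\dagger}A(C^{\top})^{\dagger}$ and $\widehat{M}=(GC)^{\dagger}GAG^{\top}((GC)^{\top})^{\dagger}$. *)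

(* Defs.v *)
From mathcomp Require Import all_boot all_order all_algebra.
From mathcomp Require Import complex spectral.
From mathcomp Require Import all_classical all_reals all_analysis.

Set Implicit Arguments.
Unset Strict Implicit.
Unset Printing Implicit Defensive.

Import Order.TTheory GRing.Theory Num.Theory.
Import numFieldNormedType.Exports.

Local Open Scope classical_set_scope.
Local Open Scope ring_scope.

Section Matrices.
Context {R : realType}.

Definition l2norm m (x : 'cV[R]_m) : R := Num.sqrt (\sum_i x i 0 ^+ 2).

Definition frobenius m n (A : 'M[R]_(m, n)) : R :=
  Num.sqrt (\sum_i \sum_j A i j ^+ 2).

Lemma frobenius_sqr m n (A : 'M[R]_(m, n)) :
  frobenius A ^+ 2 = \tr (A^T *m A).
Proof.
rewrite sqr_sqrtr; last by do 2![apply: sumr_ge0 => ? _]; exact: sqr_ge0.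
rewrite exchange_big; apply: eq_bigr => j _.
by rewrite mxE; apply: eq_bigr => i _; rewrite mxE expr2.
Qed.

(* The i-th singular value of A is the square root of the i-th eigenvalue of
   A^T A.  [spectral_diag] (the eigenvalues, with multiplicity, of a normal
   matrix) is only available over a closed field, hence the detour by R[i];
   the eigenvalues are real and nonnegative, see [singular_value_char_poly]. *)
Definition singular_value m n (A : 'M[R]_(m, n)) (i : 'I_n) : R :=
  Num.sqrt (complex.Re (spectral_diag (map_mx (real_complex R) (A^T *m A)) 0 i)).

Lemma singular_value_char_poly m n (A : 'M[R]_(m, n)) :
  char_poly (A^T *m A) = \prod_i ('X - (singular_value A i ^+ 2)%:P).
Proof.
set f := real_complex R.
pose B := map_mx f (A^T *m A); pose V := spectralmx B.
pose d := spectral_diag B.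
have freal k l (N : 'M[R]_(k, l)) : map_mx f N \is a realmx.
  by apply/mxOverP => i j; rewrite mxE; apply/complex_realP; exists (N i j).
have Bherm : B \is hermsymmx.
  apply: realsym_hermsym; last exact: freal.
  rewrite qualifE/=; apply/eqP.
  by rewrite expr0 scale1r map_mx_id// map_trmx trmx_mul trmxK.
have /orthomx_spectralP BE := hermitian_normalmx Bherm.
have Vu : V \in unitmx by exact: spectral_unit.
have dE : diag_mx d = V *m B *m invmx V.
  by rewrite [in RHS]BE -!/V -!/d !mulmxA mulmxV// mul1mx mulmxK.
have d_ge0 i : 0 <= d 0 i.
  have -> : d 0 i = diag_mx d i i by rewrite mxE eqxx mulr1n.
  pose Q := V *m map_mx f A^T.
  have -> : diag_mx d = Q *m (map_mx Num.conj Q^T).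
    rewrite dE invmx_unitary ?spectral_unitarymx// /Q /B map_mxM !mulmxA.
    by rewrite trmx_mul map_mxM map_trmx trmxK (realmxC (freal _ _ _)) ?mulmxA.
  by rewrite mxE; apply: sumr_ge0 => k _; rewrite !mxE -normCK exprn_ge0.
have sE i : f (singular_value A i ^+ 2) = d 0 i.
  rewrite /singular_value sqr_sqrtr.
    by rewrite [LHS]RRe_real// ger0_real// d_ge0.
  by have := d_ge0 i; rewrite /d lecE => /andP[].
apply: (map_poly_inj f).
rewrite map_char_poly -/B rmorph_prod/=.
rewrite (eq_bigr (fun i => 'X - (d 0 i)%:P)); last first.
  by move=> i _; rewrite rmorphB/= map_polyX map_polyC -sE.
have -> : char_poly B = char_poly (diag_mx d).
  rewrite /char_poly dE /char_poly_mx.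
  have -> : 'X%:M - map_mx polyC (V *m B *m invmx V) =
    map_mx polyC V *m ('X%:M - map_mx polyC B) *m map_mx polyC (invmx V).
    rewrite mulmxBr mulmxBl -!map_mxM; congr (_ - _).
    by rewrite scalar_mxC -mulmxA -map_mxM mulmxV// map_mx1 mulmx1.
  rewrite !det_mulmx mulrAC -det_mulmx -map_mxM mulmxV// map_mx1 det1.
  by rewrite mul1r.
rewrite char_poly_trig ?diag_mx_is_trig//.
by apply: eq_bigr => i _; rewrite mxE eqxx mulr1n.
Qed.

Definition nuclear_norm m n (A : 'M[R]_(m, n)) : R :=
  \sum_(i < n) singular_value A i.

(* The index set I is the range of f; the order of the columns is free. *)
Definition column_subset n r (A : 'M[R]_n) (C : 'M[R]_(n, r)) : Prop :=
  exists2 f : 'I_r -> 'I_n, injective f & C = colsub f A.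

Definition is_argmin (T : Type) (f : T -> R) (x : T) : Prop :=
  forall y, f x <= f y.

(* X is the Moore-Penrose pseudoinverse of A (the four Penrose equations). *)
Definition is_pinv m n (A : 'M[R]_(m, n)) (X : 'M[R]_(n, m)) : Prop :=
  [/\ A *m X *m A = A, X *m A *m X = X, (A *m X)^T = A *m X
    & (X *m A)^T = X *m A].

Lemma pinv_argmin n r (B : 'M[R]_n) (C : 'M[R]_(n, r)) (X : 'M[R]_(r, n)) :
  is_pinv C X ->
  is_argmin (fun M => frobenius (B - C *m M *m C^T) ^+ 2) (X *m B *m X^T).
Proof.
move=> [CXC _ CXT _] M; set P := C *m X in CXC CXT.
have PC : P *m C = C by [].
have CP : C^T *m P = C^T by rewrite -[in LHS]CXT -trmx_mul PC.
set X0 := B - _ *m _ *m C^T.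
have X0E : X0 = B - P *m B *m P.
  by rewrite /X0 -{2}CXT trmx_mul !mulmxA.
have PP : P *m P = P by rewrite /P mulmxA CXC.
have PX0P : P *m X0 *m P = 0.
  have -> : P *m X0 *m P = P *m B *m P - (P *m P) *m B *m (P *m P).
    by rewrite X0E mulmxBr mulmxBl !mulmxA.
  by rewrite PP subrr.
set D := C *m (X *m B *m X^T - M) *m C^T.
have -> : B - C *m M *m C^T = X0 + D.
  by rewrite /D mulmxBr mulmxBl addrA /X0 subrK.
have DE : D = P *m D *m P by rewrite /D -!mulmxA CP !mulmxA PC.
clearbody P; clear PC CP CXC X0E.
have XD : \tr (X0^T *m D) = 0.
  rewrite DE mulmxA mxtrace_mulC !mulmxA.
  have -> : P *m X0^T *m P = (P *m X0 *m P)^T.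
    by rewrite !trmx_mul CXT mulmxA.
  by rewrite PX0P trmx0 !mul0mx linear0.
have DX : \tr (D^T *m X0) = 0 by rewrite -mxtrace_tr trmx_mul trmxK.
clearbody X0 D; rewrite !frobenius_sqr (raddfD trmx) mulmxDl !mulmxDr !mxtraceD XD DX addr0 add0r.
by rewrite lerDl -frobenius_sqr sqr_ge0.
Qed.

(* The explicit minimizers C^+ A (C^T)^+ (case G = 1) and
   (GC)^+ G A G^T ((GC)^T)^+; note that (X^T)^+ = (X^+)^T. *)
Lemma sketched_pinv_argmin n r t (A : 'M[R]_n) (C : 'M[R]_(n, r))
    (G : 'M[R]_(t, n)) (X : 'M[R]_(r, t)) :
  is_pinv (G *m C) X ->
  is_argmin (fun M => frobenius (G *m (A - C *m M *m C^T) *m G^T) ^+ 2)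
    (X *m (G *m A *m G^T) *m X^T).
Proof.
move=> /(@pinv_argmin _ _ (G *m A *m G^T)) XP M.
have E N : G *m (A - C *m N *m C^T) *m G^T =
           G *m A *m G^T - G *m C *m N *m (G *m C)^T.
  by rewrite mulmxBr mulmxBl trmx_mul !mulmxA.
by rewrite !E; exact: XP.
Qed.

Definition subspace_embedding t n r (eps : R) (X : 'M[R]_(t, n))
    (B : 'M[R]_(n, r)) : Prop :=
  forall x : 'cV[R]_r,
    (1 - eps) * l2norm (B *m x) ^+ 2 <= l2norm (X *m B *m x) ^+ 2 /\
    l2norm (X *m B *m x) ^+ 2 <= (1 + eps) * l2norm (B *m x) ^+ 2.

End Matrices.

Section Probability.
Context d {Om : measurableType d} {R : realType} (P : probability Om R).

(* Q holds with probability at least p.  Q need not be measurable (it may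
   depend on the choice of a minimizer), so we ask for a measurable event of
   probability at least p on which Q holds; for measurable Q this is
   p <= P Q. *)
Definition with_prob_ge (p : R) (Q : set Om) : Prop :=
  exists E : set Om, [/\ measurable E, E `<=` Q & (p%:E <= P E)%E].

Definition mutually_independent (I : finType) (X : I -> {RV P >-> R}) : Prop :=
  forall (J : {set I}) (B : I -> set R),
    (forall i, i \in J -> measurable (B i)) ->
    P (\bigcap_(i in [set i | i \in J]) (X i @^-1` B i)) =
    (\prod_(i in J) P (X i @^-1` B i))%E.

(* X ~ N(0, v) with v the variance; [normal_prob] takes the standard
   deviation. *)
Definition centered_gaussian (v : R) (X : {RV P >-> R}) : Prop :=
  forall B : set R, measurable B ->
    distribution P X B = normal_prob 0 (Num.sqrt v) B.

Definition gaussian_iid t n (v : R) (G : 'I_t -> 'I_n -> {RV P >-> R}) : Prop :=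
  mutually_independent (fun ij : 'I_t * 'I_n => G ij.1 ij.2) /\
  forall i j, centered_gaussian v (G i j).

Definition random_matrix t n (G : 'I_t -> 'I_n -> {RV P >-> R}) (w : Om) :
  'M[R]_(t, n) := \matrix_(i, j) G i j w.

Definition oblivious_subspace_embedding t n (r : nat) (eps delta : R)
    (X : Om -> 'M[R]_(t, n)) : Prop :=
  forall U : 'M[R]_(n, r),
    with_prob_ge (1 - delta) [set w | subspace_embedding eps (X w) U].

End Probability.

Definition c1 {R : realType} (r t : nat) : R :=
  (1 + Num.sqrt (r%:R / t%:R)) ^+ 2
  * Num.sqrt (1 + Num.sqrt (2 / r%:R)) * Num.sqrt (1 + 2 / t%:R).

Definition c2 {R : realType} (r : nat) (eps Delta : R) : R :=
  Delta / ((1 - eps) ^+ 2 * Num.sqrt r%:R).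

(* Main.v *)
Require Import Defs.
From mathcomp Require Import all_boot all_order all_algebra.
From mathcomp Require Import all_classical all_reals all_analysis.
From mathcomp Require Import measurable_realfun ring lra.

(** Why the bound holds.  Write C = U T with U orthonormal and T invertible,
    S = G^T G, H = U^T S U, and X0 = A - C Mstar C^T.  The residual of Mhat is
    X0 + U N U^T for some r x r matrix N, and the normal equation of the
    sketched problem reads H N H = - U^T S X0 S U.  When G embeds the range of
    U, H is bounded below by 1 - eps, hence
      |N|_F <= |U^T S X0 S U|_F / (1 - eps)^2.
    Duality between the nuclear norm and contractions gives
      |X0 + U N U^T|_* <= |X0|_* + sqrt r |N|_F
    ([nuclear_norm_perturb], [sketched_residual_bound]).

    It remains to bound |U^T S X0 S U|_F on average.  Let v_k be right singular
    vectors of X0, with singular values s_k.  Since X0 is the sum of the rank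
    one matrices (X0 v_k) v_k^T, the norm |U^T S X0 S U|_F is at most the sum
    over k of |U^T S X0 v_k| |U^T S v_k| ([frobenius_congruence_le]).  For a
    fixed vector x the fourth moments of independent Gaussians give
      E |U^T S x|^2 <= (1 + (r + 1) / t) |x|^2
    ([sketched_projection_second_moment]).  By the inequality
    a b <= (a^2 / s_k + s_k b^2) / 2 with a = |U^T S X0 v_k| and
    b = |U^T S v_k| (a = 0 when s_k = 0), the expectation is at most
    (1 + (r + 1) / t) |X0|_*, and
      1 + (r + 1) / t <= (1 + sqrt (r / t))^2 <= c1 r t.
    Markov's inequality and a union bound conclude.

    The Gaussian computation rests on two ingredients.  The moments of a
    Gaussian are the derivatives at 0 of its moment generating function, which
    is found by completing the square.  Expectations of products of functions
    of mutually independent variables factor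
    ([mutually_independent_Rintegral_prod]).  Together these give the fourth
    moment formula [gaussian_wick4], hence the second moment of a quadratic
    form ([gaussian_quadratic_form]). *)

Set Implicit Arguments.
Unset Strict Implicit.
Unset Printing Implicit Defensive.

Import Order.TTheory GRing.Theory Num.Theory.
Import numFieldNormedType.Exports.
Local Open Scope classical_set_scope.
Local Open Scope ring_scope.

(** * The Frobenius norm *)

Section Frobenius.
Context {R : realType}.

Lemma trmxB m n (A B : 'M[R]_(m, n)) : (A - B)^T = A^T - B^T.
Proof. exact: raddfB. Qed.

Lemma trmxZ m n a (A : 'M[R]_(m, n)) : (a *: A)^T = a *: A^T.
Proof. exact: linearZ. Qed.

Lemma frobenius_ge0 m n (A : 'M[R]_(m, n)) : 0 <= frobenius A.
Proof. exact: sqrtr_ge0. Qed.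

Lemma frobenius_sqrE m n (A : 'M[R]_(m, n)) :
  frobenius A ^+ 2 = \sum_i \sum_j A i j ^+ 2.
Proof.
by rewrite sqr_sqrtr//; do 2![apply: sumr_ge0 => ? _]; exact: sqr_ge0.
Qed.

Lemma l2norm_frobenius m (x : 'cV[R]_m) : l2norm x = frobenius x.
Proof. by congr Num.sqrt; apply: eq_bigr => i _; rewrite big_ord1. Qed.

Lemma frobenius_eq0 m n (A : 'M[R]_(m, n)) : frobenius A = 0 -> A = 0.
Proof.
move=> /(congr1 (fun x => x ^+ 2)); rewrite frobenius_sqrE expr0n/= => /eqP.
rewrite psumr_eq0 => [/allP A0|i _]; last by apply: sumr_ge0 => j _;
  exact: sqr_ge0.
apply/matrixP => i j; rewrite mxE; have := A0 i (mem_index_enum _).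
rewrite /= psumr_eq0 => [/allP/(_ j (mem_index_enum _))|k _];
  last exact: sqr_ge0.
by rewrite /= sqrf_eq0 => /eqP.
Qed.

Lemma frobenius0 m n : frobenius (0 : 'M[R]_(m, n)) = 0.
Proof.
rewrite /frobenius big1 ?sqrtr0// => i _; rewrite big1// => j _.
by rewrite mxE expr0n.
Qed.

Lemma frobenius_tr m n (A : 'M[R]_(m, n)) : frobenius A^T = frobenius A.
Proof.
congr Num.sqrt; rewrite exchange_big; apply: eq_bigr => i _.
by apply: eq_bigr => j _; rewrite mxE.
Qed.

Lemma frobenius_sqr_col m n (A : 'M[R]_(m, n)) :
  frobenius A ^+ 2 = \sum_j frobenius (col j A) ^+ 2.
Proof.
rewrite frobenius_sqrE exchange_big; apply: eq_bigr => j _.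
by rewrite frobenius_sqrE; apply: eq_bigr => i _; rewrite big_ord1 mxE.
Qed.

Lemma frobenius_sqr_trC m n (A : 'M[R]_(m, n)) :
  frobenius A ^+ 2 = \tr (A *m A^T).
Proof. by rewrite -frobenius_tr frobenius_sqr trmxK. Qed.

(** The Cauchy-Schwarz inequality for the Frobenius inner product. *)
Lemma mxtrace_le_frobenius m n (A B : 'M[R]_(m, n)) :
  \tr (A^T *m B) <= frobenius A * frobenius B.
Proof.
have [A0|A0] := eqVneq (frobenius A) 0.
  by rewrite A0 mul0r (frobenius_eq0 A0) trmx0 mul0mx mxtrace0.
have [B0|B0] := eqVneq (frobenius B) 0.
  by rewrite B0 mulr0 (frobenius_eq0 B0) mulmx0 mxtrace0.
have AB0 : 0 < frobenius A * frobenius B.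
  by rewrite mulr_gt0// lt_def frobenius_ge0 ?A0 ?B0.
have BA : \tr (B^T *m A) = \tr (A^T *m B) by rewrite -mxtrace_tr trmx_mul trmxK.
have := sqr_ge0 (frobenius (frobenius B *: A - frobenius A *: B)).
rewrite frobenius_sqr trmxB !trmxZ mulmxBl !mulmxBr.
rewrite -!scalemxAl -!scalemxAr !scalerA !raddfB/= !mxtraceZ -!frobenius_sqr BA
  => h.
by rewrite -(ler_pM2l AB0); nra.
Qed.

Lemma frobenius_mul_col m n (p : 'cV[R]_m) (q : 'cV[R]_n) :
  frobenius (p *m q^T) = frobenius p * frobenius q.
Proof.
apply/eqP; rewrite -(@eqrXn2 _ 2) ?mulr_ge0 ?frobenius_ge0//; apply/eqP.
rewrite exprMn frobenius_sqrE.
under eq_bigr => i _ do under eq_bigr => j _ do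
  rewrite mxE big_ord1 [q^T _ _]mxE exprMn.
rewrite !frobenius_sqrE.
under [X in X * _]eq_bigr => i _ do rewrite big_ord1.
under [X in _ * X]eq_bigr => i _ do rewrite big_ord1.
rewrite mulr_suml; apply: eq_bigr => i _.
by rewrite mulr_sumr.
Qed.

Lemma orthonormal_frobenius m n p (V : 'M[R]_(m, n)) (Y : 'M[R]_(n, p)) :
  V^T *m V = 1%:M -> frobenius (V *m Y) = frobenius Y.
Proof.
move=> VV; apply/eqP; rewrite -(@eqrXn2 _ 2) ?frobenius_ge0//; apply/eqP.
by rewrite !frobenius_sqr trmx_mul mulmxA -(mulmxA _ V^T) VV mulmx1.
Qed.

(** A matrix with orthonormal columns has a contractive transpose. *)
Lemma orthonormal_tr_contraction m n p (V : 'M[R]_(m, n)) (Y : 'M[R]_(m, p)) :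
  V^T *m V = 1%:M -> frobenius (V^T *m Y) <= frobenius Y.
Proof.
move=> VV; rewrite -ler_sqr ?nnegrE ?frobenius_ge0//.
rewrite -subr_ge0.
suff -> : frobenius Y ^+ 2 - frobenius (V^T *m Y) ^+ 2 =
    frobenius (Y - V *m (V^T *m Y)) ^+ 2 by exact: sqr_ge0.
rewrite !frobenius_sqr trmxB mulmxBl !mulmxBr !trmx_mul trmxK.
rewrite !mulmxA -(mulmxA _ V^T V) VV mulmx1 subrr subr0 !raddfB/=.
by [].
Qed.

End Frobenius.

(** * Right singular vectors *)

Section SingularVectors.
Context {R : realType}.

(** A Householder reflection completes a unit vector into an orthogonal
    matrix. *)
Lemma orthogonal_completion n (v : 'cV[R]_(1 + n)) :
  v^T *m v = 1%:M -> exists2 Q : 'M[R]_(1 + n), Q^T *m Q = 1%:M & lsubmx Q = v.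
Proof.
move=> v1; pose e : 'cV[R]_(1 + n) := delta_mx (lshift n 0) 0.
have e1 : e^T *m e = 1%:M.
  by rewrite trmx_delta mul_delta_mx; apply/matrixP => i j; rewrite !ord1 !mxE.
have lE (Q : 'M[R]_(1 + n)) : lsubmx Q = Q *m e.
  apply/matrixP => i j; rewrite !mxE (bigD1 (lshift n 0))//= big1.
    by rewrite !mxE !eqxx (ord1 j) mulr1 addr0.
  by move=> k k0; rewrite !mxE (negbTE k0) mulr0.
pose w := v - e; have [w0|w0] := eqVneq w 0.
  exists 1%:M; first by rewrite trmx1 mulmx1.
  by rewrite lE mul1mx; apply/esym/eqP; rewrite -subr_eq0 -/w w0.
pose a := (w^T *m w) 0 0.
have wwE : w^T *m w = a%:M by exact: mx11_scalar.
have a0 : a != 0.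
  apply: contraNneq w0 => a0; apply/eqP/frobenius_eq0/eqP.
  by rewrite -sqrf_eq0 frobenius_sqr wwE a0 mxtrace_scalar.
pose Q : 'M[R]_(1 + n) := 1%:M - (2 / a) *: (w *m w^T).
have QT : Q^T = Q.
  by rewrite /Q trmxB trmxZ trmx_mul trmxK trmx1.
exists Q.
  rewrite QT /Q mulmxBl mul1mx !mulmxBr mulmx1 -scalemxAl -scalemxAr.
  rewrite mulmxA -(mulmxA w) wwE mul_mx_scalar -scalemxAl !scalerA.
  set W := w *m w^T; apply/matrixP => i j; rewrite !mxE; field.
  exact: a0.
have ev : e^T *m v = v^T *m e.
  apply/matrixP => i j;
    rewrite !ord1 -[LHS]trace_mx11 -mxtrace_tr trmx_mul trmxK.
  by rewrite trace_mx11.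
pose b := (v^T *m e) 0 0.
have veE : v^T *m e = b%:M by exact: mx11_scalar.
have aE : a = 2 - 2 * b.
  have : a%:M = (2 - 2 * b)%:M :> 'M[R]_1.
    rewrite -wwE /w trmxB mulmxBl !mulmxBr v1 e1 ev veE.
    by rewrite -!raddfB/=; congr (_%:M); ring.
  by move/matrixP/(_ 0 0); rewrite !mxE.
have weE : w^T *m e = (b - 1)%:M.
  by rewrite /w trmxB mulmxBl veE e1 -raddfB.
rewrite lE /Q mulmxBl mul1mx -scalemxAl -mulmxA weE mul_mx_scalar scalerA.
have -> : 2 / a * (b - 1) = -1.
  have -> : b - 1 = - (a / 2) by rewrite aE; field.
  by field.
by rewrite scaleN1r opprK /w addrC subrK.
Qed.

Lemma gram_eigenvector m n (X : 'M[R]_(m, 1 + n)) :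
  exists (v : 'cV[R]_(1 + n)) (a : R),
    v^T *m v = 1%:M /\ X^T *m X *m v = a *: v.
Proof.
pose a := singular_value X (lshift n 0) ^+ 2.
have : eigenvalue (X^T *m X) a.
  rewrite eigenvalue_root_char singular_value_char_poly.
  by rewrite (bigD1 (lshift n 0))//= rootM root_XsubC eqxx.
move=> /eigenvalueP[u uE u0].
have f0 : frobenius u != 0 by apply: contraNneq u0 => /frobenius_eq0 ->.
exists ((frobenius u)^-1 *: u^T), a; split.
  rewrite trmxZ trmxK -scalemxAl -scalemxAr scalerA.
  have -> : u *m u^T = (frobenius u ^+ 2)%:M.
    by rewrite frobenius_sqr_trC trace_mx11; exact: mx11_scalar.
  by rewrite scale_scalar_mx; congr (_%:M); field.
rewrite -scalemxAr scalerA mulrC -scalerA; congr (_ *: _).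
by have /(congr1 trmx) := uE; rewrite trmxZ !trmx_mul trmxK.
Qed.

(** The columns of V are right singular vectors of X.  The induction peels
    off one eigenvector v of X^T X: the remaining columns of X Q, where Q
    completes v, are orthogonal to X v. *)
Lemma orthogonal_gram_diag m n (X : 'M[R]_(m, n)) :
  exists (V : 'M[R]_n) (d : 'rV[R]_n),
    V^T *m V = 1%:M /\ (X *m V)^T *m (X *m V) = diag_mx d.
Proof.
elim: n X => [|n IH] X.
  by exists 1%:M, 0; split; apply/matrixP => -[].
rewrite -[n.+1]/(1 + n)%N in X *.
have [v [a [v1 va]]] := gram_eigenvector X.
have [Q QQ Qv] := orthogonal_completion v1.
have [V [d [VV XV]]] := IH (X *m rsubmx Q).
have QE : Q = row_mx v (rsubmx Q) by rewrite -Qv hsubmxK.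
have vQ : v^T *m rsubmx Q = 0.
  move: QQ; rewrite {1 2}QE tr_row_mx mul_col_row -[1%:M]submxK =>
    /eq_block_mx[_ + _ _].
  move=> ->; apply/matrixP => i j; rewrite !mxE.
  by case: eqP => // /(congr1 val)/=; rewrite (ord1 i).
have QQr : (rsubmx Q)^T *m rsubmx Q = 1%:M.
  move: QQ; rewrite {1 2}QE tr_row_mx mul_col_row -[1%:M]submxK =>
    /eq_block_mx[_ _ _ ->].
  by apply/matrixP => i j; rewrite !mxE eq_rshift.
have XvQ : v^T *m X^T *m X *m rsubmx Q = 0.
  have : (X^T *m X *m v)^T *m rsubmx Q = 0.
    by rewrite va trmxZ -scalemxAl vQ scaler0.
  by rewrite !trmx_mul trmxK !mulmxA.
have gram_row p (x : 'cV[R]_p) (Y : 'M[R]_(p, n)) : x^T *m Y = 0 ->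
    (row_mx x Y)^T *m row_mx x Y = block_mx (x^T *m x) 0 0 (Y^T *m Y).
  move=> xY; rewrite tr_row_mx mul_col_row xY.
  by rewrite -[Y^T *m x]trmxK trmx_mul trmxK xY trmx0.
exists (row_mx v (rsubmx Q *m V)), (row_mx a%:M d); split.
  rewrite gram_row; last by rewrite mulmxA vQ mul0mx.
  rewrite v1 trmx_mul -mulmxA (mulmxA _ (rsubmx Q)) QQr mul1mx VV.
  by rewrite -scalar_mx_block.
rewrite mul_mx_row gram_row; last by rewrite trmx_mul !mulmxA XvQ mul0mx.
rewrite [X *m (_ *m _)]mulmxA XV diag_mx_row; congr (block_mx _ 0 0 _).
rewrite trmx_mul -mulmxA (mulmxA _ X) va -scalemxAr v1 scale_scalar_mx mulr1.
by apply/matrixP => i j; rewrite !ord1 !mxE eqxx.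
Qed.

End SingularVectors.

(** * Duality for the nuclear norm *)

Section NuclearNorm.
Context {R : realType}.

(** The columns of V are right singular vectors of X, for the singular values
    s; the two lists s and [singular_value X] agree up to order, since their
    squares are the roots of the same characteristic polynomial. *)
Lemma right_singular_basis m n (X : 'M[R]_(m, n)) :
  exists (V : 'M[R]_n) (s : 'I_n -> R),
    [/\ V^T *m V = 1%:M, (forall k, 0 <= s k),
        (X *m V)^T *m (X *m V) = diag_mx (\row_k s k ^+ 2)
      & nuclear_norm X = \sum_k s k].
Proof.
have [V [d [VV XV]]] := orthogonal_gram_diag X.
have d0 k : 0 <= d 0 k.
  have -> : d 0 k = diag_mx d k k by rewrite mxE eqxx.
  by rewrite -XV mxE; apply: sumr_ge0 => i _; rewrite mxE -expr2 sqr_ge0.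
have dE : diag_mx (\row_k Num.sqrt (d 0 k) ^+ 2) = diag_mx d.
  by congr diag_mx; apply/rowP => k; rewrite mxE sqr_sqrtr.
exists V, (fun k => Num.sqrt (d 0 k)); split => //; first by rewrite dE.
have VVt : V *m V^T = 1%:M by rewrite (mulmx1C VV).
have : char_poly (X^T *m X) = \prod_k ('X - (d 0 k)%:P).
  have <- : char_poly (diag_mx d) = \prod_k ('X - (d 0 k)%:P).
    rewrite char_poly_trig ?diag_mx_is_trig//.
    by apply: eq_bigr => i _; rewrite mxE eqxx mulr1n.
  rewrite -XV trmx_mul /char_poly /char_poly_mx !mulmxA.
  have -> : 'X%:M - map_mx polyC (V^T *m X^T *m X *m V) =
      map_mx polyC V^T *m ('X%:M - map_mx polyC (X^T *m X)) *m map_mx polyC V.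
    rewrite mulmxBr mulmxBl -!map_mxM !mulmxA; congr (_ - _).
    by rewrite scalar_mxC -mulmxA -map_mxM VV map_mx1 mulmx1.
  by rewrite !det_mulmx mulrAC -det_mulmx -map_mxM VV map_mx1 det1 mul1r.
rewrite singular_value_char_poly => cE.
have pE : perm_eq [seq singular_value X i ^+ 2 | i <- index_enum 'I_n]
    [seq d 0 i | i <- index_enum 'I_n].
  by apply: prod_XsubC_eq; rewrite !big_map.
have := @perm_big R +%R 0 R _ _ predT id
  (perm_map Num.sqrt pE).
rewrite /= !big_map => <-.
by apply: eq_bigr => i _; rewrite sqrtr_sqr ger0_norm// sqrtr_ge0.
Qed.

Lemma frobenius_col_gram_diag m n (X : 'M[R]_(m, n)) (s : 'I_n -> R) k :
  0 <= s k -> X^T *m X = diag_mx (\row_k s k ^+ 2) -> frobenius (col k X) = s k.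
Proof.
move=> s0 XX; apply/eqP; rewrite -(@eqrXn2 _ 2) ?frobenius_ge0//; apply/eqP.
rewrite frobenius_sqr trace_mx11.
move/matrixP: XX => /(_ k k); rewrite !mxE eqxx mulr1n => <-.
by apply: eq_bigr => i _; rewrite !mxE.
Qed.

(** W does not increase Euclidean norms; a column vector is normed as an
    n x 1 matrix. *)
Definition contraction m n (W : 'M[R]_(m, n)) :=
  forall x : 'cV[R]_n, frobenius (W *m x) <= frobenius x.

Lemma contraction_gram_diag m n (Y : 'M[R]_(m, n)) (b : 'I_n -> R) :
  (forall k, b k <= 1) -> Y^T *m Y = diag_mx (\row_k b k) -> contraction Y.
Proof.
move=> b1 YY x; rewrite -(@ler_pXn2r _ 2) ?nnegrE ?frobenius_ge0//.
rewrite frobenius_sqr trmx_mul -mulmxA (mulmxA _ Y) YY mulmxA mul_mx_diag.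
rewrite trace_mx11 mxE frobenius_sqrE; apply: ler_sum => k _.
by rewrite !mxE big_ord1 mulrAC -expr2 ler_piMr// sqr_ge0.
Qed.

Lemma col_mulmx m n p (A : 'M[R]_(m, n)) (B : 'M[R]_(n, p)) k :
  col k (A *m B) = A *m col k B.
Proof. by rewrite !colE mulmxA. Qed.

Lemma mxtrace_col m n (A B : 'M[R]_(m, n)) :
  \tr (A^T *m B) = \sum_k \tr ((col k A)^T *m col k B).
Proof.
rewrite /mxtrace; apply: eq_bigr => k _; rewrite big_ord1 !mxE.
by apply: eq_bigr => i _; rewrite !mxE.
Qed.

(** The nuclear norm is dual to the operator norm: contractions test it from
    below. *)
Lemma mxtrace_le_nuclear m n (W X : 'M[R]_(m, n)) :
  contraction W -> \tr (W^T *m X) <= nuclear_norm X.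
Proof.
move=> cW; have [V [s [VV s0 XV ->]]] := right_singular_basis X.
have VVt : V *m V^T = 1%:M by rewrite (mulmx1C VV).
have -> : \tr (W^T *m X) = \tr ((W *m V)^T *m (X *m V)).
  by rewrite trmx_mul -[in RHS]mulmxA [RHS]mxtrace_mulC -!mulmxA VVt mulmx1.
rewrite mxtrace_col; apply: ler_sum => k _.
apply: (le_trans (mxtrace_le_frobenius _ _)).
rewrite (frobenius_col_gram_diag (s0 k) XV) ler_piMl// col_mulmx.
apply: (le_trans (cW _)); rewrite -(@ler_pXn2r _ 2) ?nnegrE ?frobenius_ge0//.
rewrite frobenius_sqr expr1n trace_mx11.
have : (V^T *m V) k k = 1 by rewrite VV mxE eqxx.
rewrite !mxE => <-; rewrite le_eqVlt; apply/orP; left; apply/eqP.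
by apply: eq_bigr => i _; rewrite !mxE.
Qed.

(** The polar factor of Z attains the previous bound. *)
Lemma nuclear_norm_attained m n (Z : 'M[R]_(m, n)) :
  exists2 W : 'M[R]_(m, n), contraction W & \tr (W^T *m Z) = nuclear_norm Z.
Proof.
have [V [s [VV s0 ZV ->]]] := right_singular_basis Z.
have VVt : V *m V^T = 1%:M by rewrite (mulmx1C VV).
pose D := diag_mx (\row_k (s k)^-1).
have DT : D^T = D by rewrite tr_diag_mx.
exists (Z *m V *m D *m V^T); last first.
  have -> : \tr ((Z *m V *m D *m V^T)^T *m Z) =
      \tr (D *m ((Z *m V)^T *m (Z *m V))).
    by rewrite !trmx_mul trmxK DT -!mulmxA [LHS]mxtrace_mulC -!mulmxA.
  rewrite ZV mulmx_diag mxtrace_diag.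
  apply: eq_bigr => k _; rewrite !mxE.
  have [->|sk] := eqVneq (s k) 0; first by rewrite invr0 mul0r.
  by rewrite expr2 mulKf.
have cZ : contraction (Z *m V *m D).
  apply: (@contraction_gram_diag _ _ _ (fun k => (s k != 0)%:R)).
    by move=> k; case: eqP.
  move: (Z *m V) ZV => Y YY.
  rewrite trmx_mul DT -!mulmxA (mulmxA Y^T) YY !mulmx_diag.
  congr diag_mx; apply/rowP => k; rewrite !mxE.
  have [->|sk] := eqVneq (s k) 0; first by rewrite invr0 mul0r.
  by rewrite expr2 mulfK// mulVf.
move=> x; rewrite -mulmxA (le_trans (cZ _))// orthonormal_frobenius//.
by rewrite trmxK.
Qed.

(** Duality between the nuclear norm and contractions gives the triangle
    inequality; on the r-dimensional range of U a contraction has Frobenius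
    norm at most the square root of r. *)
Lemma nuclear_norm_perturb n r (X : 'M[R]_n) (U : 'M[R]_(n, r)) (N : 'M[R]_r) :
  U^T *m U = 1%:M ->
  nuclear_norm (X + U *m N *m U^T) <=
    nuclear_norm X + Num.sqrt r%:R * frobenius N.
Proof.
move=> UU; have [W cW <-] := nuclear_norm_attained (X + U *m N *m U^T).
rewrite mulmxDr mxtraceD lerD ?mxtrace_le_nuclear//.
have -> : \tr (W^T *m (U *m N *m U^T)) = \tr ((U^T *m W *m U)^T *m N).
  by rewrite !trmx_mul trmxK !mulmxA [LHS]mxtrace_mulC !mulmxA.
apply: (le_trans (mxtrace_le_frobenius _ _)).
rewrite ler_wpM2r ?frobenius_ge0//.
rewrite -(@ler_pXn2r _ 2) ?nnegrE ?frobenius_ge0 ?sqrtr_ge0//.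
rewrite [leRHS]sqr_sqrtr// frobenius_sqr_col -[leRHS]mulr1 mulr_natl -[X in _
  *+ X]card_ord -sumr_const.
apply: ler_sum => k _; rewrite -mulmxA col_mulmx.
rewrite -[leRHS](expr1n _ 2) ler_pXn2r ?nnegrE ?frobenius_ge0//.
apply: (le_trans (orthonormal_tr_contraction _ UU)).
rewrite col_mulmx (le_trans (cW _))//.
rewrite (@frobenius_col_gram_diag _ _ _ (fun=> 1))// UU.
apply/matrixP => i j; rewrite !mxE expr1n.
by [].
Qed.

End NuclearNorm.

(** * The sketched least squares problem *)

Section SketchedLeastSquares.
Context {R : realType}.

Lemma frobenius_sqrBZ m n (S F : 'M[R]_(m, n)) s :
  frobenius (S - s *: F) ^+ 2 =
    frobenius S ^+ 2 - 2 * s * \tr (F^T *m S) + s ^+ 2 * frobenius F ^+ 2.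
Proof.
have SF : \tr (S^T *m F) = \tr (F^T *m S) by rewrite -mxtrace_tr trmx_mul trmxK.
rewrite frobenius_sqr trmxB trmxZ mulmxBl !mulmxBr.
rewrite -!scalemxAl -!scalemxAr !raddfB/= !mxtraceZ SF -!frobenius_sqr.
by ring.
Qed.

(** The first-order condition of the least squares problem, obtained by moving
    M along its left-hand side, a negative multiple of the gradient. *)
Lemma argmin_normal_equation t r (B : 'M[R]_t) (L : 'M[R]_(t, r))
    (M : 'M[R]_r) :
  is_argmin (fun M => frobenius (B - L *m M *m L^T) ^+ 2) M ->
  L^T *m (B - L *m M *m L^T) *m L = 0.
Proof.
move=> Mmin; set S := B - _; set E := L^T *m S *m L.
apply: frobenius_eq0; apply/eqP; rewrite -sqrf_eq0; apply/eqP.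
set e := frobenius E ^+ 2; pose F := L *m E *m L^T.
have FS : \tr (F^T *m S) = e.
  rewrite /e frobenius_sqr {2}/E /F !trmx_mul trmxK -!mulmxA [LHS]mxtrace_mulC.
  by rewrite !mulmxA.
have h s : 2 * s * e <= s ^+ 2 * frobenius F ^+ 2.
  have := Mmin (M + s *: E).
  have -> : B - L *m (M + s *: E) *m L^T = S - s *: F.
    by rewrite mulmxDr mulmxDl opprD addrA -scalemxAr -scalemxAl.
  by rewrite -/S frobenius_sqrBZ FS; lra.
have e0 : 0 <= e by exact: sqr_ge0.
set f := frobenius F ^+ 2 in h; have f0 : 0 <= f by exact: sqr_ge0.
(* Any small enough positive step would do; adding 1 keeps the quotient
   meaningful when f = 0. *)
have {}h := h (e / (f + 1)).
have f1 : 0 < f + 1 by lra.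
have {}h : 2 * e ^+ 2 * (f + 1) <= e ^+ 2 * f.
  have := h; rewrite -(ler_pM2r (exprn_gt0 2 f1)).
  congr (_ <= _); field; lra.
nra.
Qed.

(** If the quadratic form of H is at least c, then H expands norms by c. *)
Lemma frobenius_mul_lower r p (H : 'M[R]_r) (c : R) (Y : 'M[R]_(r, p)) :
  0 <= c ->
  (forall x : 'cV[R]_r, c * frobenius x ^+ 2 <= \tr (x^T *m (H *m x))) ->
  c * frobenius Y <= frobenius (H *m Y).
Proof.
move=> c0 Hc; rewrite -(@ler_pXn2r _ 2) ?nnegrE ?mulr_ge0 ?frobenius_ge0//.
rewrite exprMn !frobenius_sqr_col mulr_sumr; apply: ler_sum => k _.
rewrite -exprMn ler_pXn2r ?nnegrE ?mulr_ge0 ?frobenius_ge0//.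
rewrite col_mulmx; set x := col k Y.
have [->|x0] := eqVneq (frobenius x) 0; first by rewrite mulr0 frobenius_ge0.
have x1 : 0 < frobenius x by rewrite lt_def x0 frobenius_ge0.
rewrite -(ler_pM2l x1) mulrCA -expr2.
exact: le_trans (Hc _) (mxtrace_le_frobenius _ _).
Qed.

(** A QR-type factorization, read off the right singular vectors of C. *)
Lemma orthonormal_factorization n r (C : 'M[R]_(n, r)) :
  \rank C = r ->
  exists (U : 'M[R]_(n, r)) (T : 'M[R]_r),
    [/\ C = U *m T, U^T *m U = 1%:M & T \in unitmx].
Proof.
move=> rC; have [V [s [VV s0 CV _]]] := right_singular_basis C.
have VVt : V *m V^T = 1%:M by rewrite (mulmx1C VV).
have Cfree : row_free C^T by rewrite -row_leq_rank mxrank_tr rC.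
have sn0 k : s k != 0.
  rewrite -(frobenius_col_gram_diag (s0 k) CV).
  apply/eqP => /frobenius_eq0; rewrite col_mulmx => CVk.
  have /eqP : (col k V)^T *m C^T = 0 by rewrite -trmx_mul CVk trmx0.
  rewrite mulmx_free_eq0// => /eqP Vk.
  have /matrixP/(_ k k) : V^T *m V = 1%:M by [].
  rewrite !mxE eqxx big1 => [/eqP|i _]; first by rewrite eq_sym oner_eq0.
  have /matrixP/(_ 0 i) := Vk; rewrite !mxE => ->; first by rewrite mul0r.
pose D := diag_mx (\row_k (s k)^-1); pose E := diag_mx (\row_k s k).
have DE : D *m E = 1%:M.
  by rewrite mulmx_diag -diag_const_mx; congr diag_mx; apply/rowP => k;
    rewrite !mxE mulVf.
have DT : D^T = D by rewrite tr_diag_mx.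
exists (C *m V *m D), (E *m V^T); split.
- by rewrite -!mulmxA (mulmxA D) DE mul1mx VVt mulmx1.
- move: (C *m V) CV => Y YY.
  rewrite trmx_mul DT -!mulmxA (mulmxA Y^T) YY !mulmx_diag -diag_const_mx.
  by congr diag_mx; apply/rowP => k; rewrite !mxE expr2 mulfK// mulVf.
- have : (V *m D) *m (E *m V^T) = 1%:M by rewrite -mulmxA (mulmxA D) DE mul1mx.
  by case/mulmx1_unit.
Qed.

Lemma congruence_unit_eq0 r (T Z : 'M[R]_r) :
  T^T *m Z *m T = 0 -> T \in unitmx -> Z = 0.
Proof.
move=> TZT Tu; have TTu : T^T \in unitmx by rewrite unitmx_tr.
by rewrite -[Z](mulKmx TTu) -[T^T *m Z](mulmxK Tu) TZT mul0mx mulmx0.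
Qed.

(** The residual of the sketched minimizer differs from the residual of any M0
    by a matrix U N U^T supported on the range of C, and the normal equation
    of the sketched problem determines N: H N H = - U^T S X0 S U, where
    S = G^T G and H = U^T S U is bounded below by c. *)
Lemma sketched_residual_bound n r t (A : 'M[R]_n) (U : 'M[R]_(n, r))
    (T : 'M[R]_r) (G : 'M[R]_(t, n)) (c : R) (M0 Mh : 'M[R]_r)
    (C := U *m T) (X0 := A - C *m M0 *m C^T) :
  U^T *m U = 1%:M -> T \in unitmx -> 0 < c ->
  (forall x : 'cV[R]_r,
     c * frobenius (U *m x) ^+ 2 <= frobenius (G *m U *m x) ^+ 2) ->
  is_argmin
    (fun M => frobenius (G *m (A - C *m M *m C^T) *m G^T) ^+ 2) Mh ->
  nuclear_norm (A - C *m Mh *m C^T) <= nuclear_norm X0 + Num.sqrt r%:R *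
    (frobenius ((G^T *m G *m U)^T *m X0 *m (G^T *m G *m U)) / c ^+ 2).
Proof.
move=> UU Tu c0 GU Mmin; pose N := T *m (M0 - Mh) *m T^T.
have XN : A - C *m Mh *m C^T = X0 + U *m N *m U^T.
  have -> : U *m N *m U^T = C *m (M0 - Mh) *m C^T.
    by rewrite /N /C trmx_mul !mulmxA.
  by rewrite mulmxBr mulmxBl addrA /X0 subrK.
clearbody X0; rewrite XN (le_trans (nuclear_norm_perturb _ _ UU))// lerD2l.
rewrite ler_wpM2l ?sqrtr_ge0// ler_pdivlMr ?exprn_gt0//.
pose H := (G *m U)^T *m (G *m U).
have HT : H^T = H by rewrite /H trmx_mul trmxK.
have Hc (x : 'cV[R]_r) : c * frobenius x ^+ 2 <= \tr (x^T *m (H *m x)).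
  have := GU x; rewrite orthonormal_frobenius// => /le_trans; apply.
  by rewrite frobenius_sqr /H !trmx_mul !mulmxA.
have HNH : (G^T *m G *m U)^T *m X0 *m (G^T *m G *m U) = - (H *m N *m H).
  have E (L : 'M[R]_(n, r)) M : G *m (A - L *m M *m L^T) *m G^T =
      G *m A *m G^T - G *m L *m M *m (G *m L)^T.
    by rewrite mulmxBr mulmxBl trmx_mul !mulmxA.
  have : (G *m C)^T *m (G *m (A - C *m Mh *m C^T) *m G^T) *m (G *m C) = 0.
    rewrite E; apply: argmin_normal_equation => M.
    by have := Mmin M; rewrite !E.
  rewrite XN => eq0.
  have {eq0} : T^T *m ((G^T *m G *m U)^T *m X0 *m (G^T *m G *m U) + H *m N *m H)
      *m T = 0.
    rewrite -[RHS]eq0 /H /C !trmx_mul trmxK.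
    by rewrite !(mulmxDr, mulmxDl) !mulmxA.
  move=> /congruence_unit_eq0 /(_ Tu) /eqP.
  by rewrite addr_eq0 => /eqP; rewrite !mulmxA.
have frobeniusN m p (Y : 'M[R]_(m, p)) : frobenius (- Y) = frobenius Y.
  congr Num.sqrt; apply: eq_bigr => i _; apply: eq_bigr => j _.
  by rewrite mxE sqrrN.
rewrite HNH frobeniusN -mulmxA expr2 mulrA.
apply: le_trans (frobenius_mul_lower _ (ltW c0) Hc).
rewrite mulrC (ler_wpM2l (ltW c0))// mulrC -[leRHS]frobenius_tr trmx_mul HT
  -[frobenius N]frobenius_tr.
exact: frobenius_mul_lower (ltW c0) Hc.
Qed.

(** Expanding X along the orthonormal columns of V writes Y^T X Y as a sum of
    rank one matrices; pairing this sum with Y^T X Y itself bounds the norm. *)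
Lemma frobenius_congruence_le n p (X : 'M[R]_n) (V : 'M[R]_n)
    (Y : 'M[R]_(n, p)) :
  V^T *m V = 1%:M ->
  frobenius (Y^T *m X *m Y) <=
    \sum_k frobenius (Y^T *m (X *m col k V)) * frobenius (Y^T *m col k V).
Proof.
move=> VV; have VVt : V *m V^T = 1%:M by rewrite (mulmx1C VV).
set Z := Y^T *m X *m Y.
have ZE : Z = \sum_k (Y^T *m (X *m col k V)) *m (Y^T *m col k V)^T.
  have -> : Z = (Y^T *m (X *m V)) *m (Y^T *m V)^T.
    by rewrite /Z trmx_mul trmxK -!mulmxA (mulmxA V) VVt mul1mx.
  apply/matrixP => i j; rewrite mxE summxE; apply: eq_bigr => k _.
  by rewrite -!col_mulmx !mxE big_ord1 !mxE.
have [->|Z0] := eqVneq (frobenius Z) 0.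
  by apply: sumr_ge0 => k _; rewrite mulr_ge0 ?frobenius_ge0.
have Z1 : 0 < frobenius Z by rewrite lt_def Z0 frobenius_ge0.
rewrite -(ler_pM2l Z1) -expr2 frobenius_sqr {2}ZE mulmx_sumr raddf_sum
  mulr_sumr.
apply: ler_sum => k _; rewrite -frobenius_mul_col.
exact: mxtrace_le_frobenius.
Qed.

End SketchedLeastSquares.

(** * Integration against a density *)

Section Density.
Local Open Scope ereal_scope.
Context d d' {T : measurableType d} {Y : measurableType d'} {R : realType}.
Variables (mu : {measure set T -> \bar R}) (nu : {measure set Y -> \bar R}).
Variables (phi : T -> Y) (h : T -> R).
Hypothesis mphi : measurable_fun [set: T] phi.
Hypothesis mh : measurable_fun [set: T] h.
Hypothesis h0 : forall x, (0 <= h x)%R.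
Hypothesis nuE : forall B, measurable B ->
  nu B = \int[mu]_(x in phi @^-1` B) (h x)%:E.

Import HBNNSimple.

Let mphiV B : measurable B -> measurable (phi @^-1` B).
Proof. by move=> mB; rewrite -[_ @^-1` _]setTI; exact: mphi. Qed.

Let integral_density_nnsfun (s : {nnsfun Y >-> R}) :
  \int[nu]_y (s y)%:E = \int[mu]_x ((h x)%:E * (s (phi x))%:E).
Proof.
have ms r : measurable (s @^-1` [set r]) by exact: measurable_sfunP.
rewrite integralT_nnsfun sintegralE.
transitivity (\int[mu]_x
    (\sum_(r \in range s) ((h x)%:E * (r * \1_(s @^-1` [set r]) (phi x))%:E))).
  rewrite ge0_integral_fsum//; last 2 first.
  - move=> r; apply: emeasurable_funM; first exact/measurable_EFinP.
    apply/measurable_EFinP/measurable_funM => //.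
    by apply: measurableT_comp => //; exact: measurable_indic.
  - move=> r x _; rewrite mule_ge0 ?lee_fin//.
    exact: (nnfun_muleindic_ge0 s r (phi x)).
  apply: eq_fsbigr => r /[!inE] -[y _ <-].
  rewrite nuE// [in LHS]integral_mkcond -ge0_integralZl//=; last 3 first.
  - apply/(measurable_restrict _ (mphiV (ms _)) measurableT).
    exact/measurable_funTS/measurable_EFinP.
  - by move=> x _; rewrite patchE; case: ifP; rewrite // lee_fin.
  - by rewrite lee_fin.
  apply: eq_integral => x _; rewrite patchE -EFinM indicE.
  have -> : (x \in phi @^-1` (s @^-1` [set s y])) =
            (phi x \in s @^-1` [set s y]) by [].
  by case: (phi x \in _); rewrite /= ?mulr1 ?mulr0 ?mule0// -EFinM mulrC.
apply: eq_integral => x _; rewrite [in RHS]fimfunE -fsumEFin// ge0_mule_fsumr//.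
by move=> r; exact: (nnfun_muleindic_ge0 s r (phi x)).
Qed.

(** If nu is the image under phi of the measure with density h with respect to
    mu, as a set function, then integrals against nu are integrals of h
    (f o phi) against mu. *)
Lemma ge0_integral_density (f : Y -> R) :
  measurable_fun [set: Y] f -> (forall y, 0 <= f y)%R ->
  \int[nu]_y (f y)%:E = \int[mu]_x (h x * f (phi x))%:E.
Proof.
move=> mf f0.
have mEf : measurable_fun [set: Y] (EFin \o f) by exact/measurable_EFinP.
pose f_ := nnsfun_approx measurableT mEf.
have f_cvg y : (f_ n y)%:E @[n --> \oo] --> (f y)%:E.
  by apply: (cvg_nnsfun_approx measurableT mEf) => // z _; rewrite lee_fin.
have f_nd y : {homo (fun n => (f_ n y)) : m n / (m <= n)%N >-> (m <= n)%R}.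
  by move=> m n mn; exact/lefP/nd_nnsfun_approx.
transitivity (limn (fun n => \int[nu]_y (f_ n y)%:E)).
  rewrite -monotone_convergence//.
  - by apply: eq_integral => y _; apply/esym/cvg_lim.
  - by move=> n; exact/measurable_EFinP/measurable_funP.
  - by move=> n y _; rewrite lee_fin.
  - by move=> y _ m n mn; rewrite lee_fin f_nd.
under eq_fun do rewrite integral_density_nnsfun.
rewrite -monotone_convergence//; last 3 first.
- move=> n; apply: emeasurable_funM; apply/measurable_EFinP => //.
  exact: measurableT_comp.
- by move=> n x _; rewrite mule_ge0 ?lee_fin.
- by move=> x _ m n mn; rewrite lee_wpmul2l ?lee_fin ?f_nd.
apply: eq_integral => x _; apply/cvg_lim => //.
by rewrite EFinM; apply: cvgeZl.
Qed.

End Density.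

(** * Moments of a centered Gaussian *)

Section GaussianMoments.
Context {R : realType}.
Variable v : R.
Hypothesis v_gt0 : 0 < v.

Let sigma_neq0 : Num.sqrt v != 0.
Proof. by rewrite gt_eqF// sqrtr_gt0. Qed.

Let mexp k (s : R) : measurable_fun [set: R] (fun x => x ^+ k * expR (s * x)).
Proof.
apply: measurable_funM; first exact: measurable_funX.
by apply: measurableT_comp => //; exact: measurable_funM.
Qed.

(** Completing the square: the moment generating function reduces to the total
    mass of a shifted Gaussian. *)
Lemma ge0_integral_normal_prob_expR (s : R) :
  (\int[normal_prob 0 (Num.sqrt v)]_x (expR (s * x))%:E =
   (expR (v * s ^+ 2 / 2))%:E)%E.
Proof.
have ms : measurable_fun [set: R] (fun x : R => expR (s * x)).
  by apply: measurableT_comp => //; exact: measurable_funM.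
rewrite (@ge0_integral_density _ _ _ _ _ lebesgue_measure _ id
  (normal_pdf 0 (Num.sqrt v)))//; last 2 first.
- exact: measurable_normal_pdf.
- by move=> x; exact: normal_pdf_ge0.
transitivity (\int[lebesgue_measure]_x
    ((expR (v * s ^+ 2 / 2))%:E * (normal_pdf (s * v) (Num.sqrt v) x)%:E))%E.
  apply: eq_integral => x _; rewrite !normal_pdfE//= -EFinM; congr EFin.
  rewrite [RHS]mulrCA -[LHS]mulrA; congr (_ * _); rewrite /normal_fun -!expRD;
    congr expR.
  by rewrite sqr_sqrtr ?ltW//; field; rewrite gt_eqF.
rewrite ge0_integralZl//= ?integral_normal_pdf ?mule1//.
- by apply/measurable_EFinP; exact: measurable_normal_pdf.
- by move=> x _; rewrite lee_fin normal_pdf_ge0.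
Qed.

Let integrable_expR (s : R) :
  (normal_prob 0 (Num.sqrt v)).-integrable [set: R]
    (EFin \o (fun x => expR (s * x))).
Proof.
apply/integrableP; split.
  by apply/measurable_EFinP/measurableT_comp => //; exact: measurable_funM.
under eq_integral do rewrite /= ger0_norm ?expR_ge0//.
by rewrite ge0_integral_normal_prob_expR ltry.
Qed.

(* For s' within 1 of s, bound k s dominates x ^+ k * expR (s' * x):
   |x| ^+ k is at most k! expR |x|, and expR (s' x) at most
   expR (s x) expR |x|. *)
Let bound (k : nat) (s x : R) : R :=
  k`!%:R * (expR ((s + 2) * x) + expR ((s - 2) * x)).

Let integrable_bound k s :
  (normal_prob 0 (Num.sqrt v)).-integrable [set: R] (EFin \o bound k s).
Proof.
rewrite /bound /comp; under eq_fun do rewrite EFinM EFinD.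
by apply: integrableZl => //; apply: integrableD => //; exact: integrable_expR.
Qed.

Let le_bound k (s s' x : R) : `|s' - s| <= 1 ->
  `|x ^+ k * expR (s' * x)| <= bound k s x.
Proof.
move=> s's; rewrite normrM normrX (ger0_norm (expR_ge0 _)).
have xk : `|x| ^+ k <= k`!%:R * expR `|x|.
  case: k => [|k]; first by rewrite expr0 mul1r -[leLHS]expR0 ler_expR.
  have := expR_ge1Dxn k (normr_ge0 x).
  have kf : 0 < k.+1`!%:R :> R by rewrite ltr0n fact_gt0.
  move=> h; rewrite -ler_pdivrMl// mulrC; apply: le_trans h; lra.
have sx : expR (s' * x) <= expR (s * x) * expR `|x|.
  rewrite -expRD ler_expR -lerBlDl -mulrBl (le_trans (ler_norm _))//.
  by rewrite normrM ler_piMl.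
have xx : expR `|x| * expR `|x| <= expR (2 * x) + expR (- 2 * x).
  rewrite -expRD; case: (ger0P x) => _.
    by rewrite (_ : x + x = 2 * x); [rewrite lerDl expR_ge0|ring].
  by rewrite (_ : - x - x = - 2 * x); [rewrite lerDr expR_ge0|ring].
apply: (@le_trans _ _ (k`!%:R * expR `|x| * (expR (s * x) * expR `|x|))).
  by apply: ler_pM => //; rewrite ?exprn_ge0 ?expR_ge0.
rewrite /bound -mulrA ler_wpM2l// (mulrDl s 2) (mulrDl s (-2)) !expRD -mulrDr.
by rewrite mulrCA ler_wpM2l ?expR_ge0.
Qed.

Lemma integrable_normal_prob_expR k (s : R) :
  (normal_prob 0 (Num.sqrt v)).-integrable [set: R]
    (EFin \o (fun x => x ^+ k * expR (s * x))).
Proof.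
apply: (le_integrable measurableT _ _ (integrable_bound k s)).
  by apply/measurable_EFinP; exact: mexp.
move=> x _ /=; rewrite lee_fin (le_trans (@le_bound k s s x _))//.
  by rewrite subrr normr0.
exact: ler_norm.
Qed.

(** The k-th derivative of the moment generating function of the centered
    Gaussian of variance v, as an expectation. *)
Definition gaussian_mgf k (s : R) : R :=
  \int[normal_prob 0 (Num.sqrt v)]_x (x ^+ k * expR (s * x)).

Lemma is_derive_gaussian_mgf (k : nat) (s : R) :
  is_derive s 1 (gaussian_mgf k) (gaussian_mgf k.+1 s).
Proof.
pose f (s x : R) := x ^+ k * expR (s * x).
have df (s' x : R) : is_derive s' 1 (f ^~ x) (x ^+ k.+1 * expR (s' * x)).
  rewrite /f; apply: is_derive_eq; rewrite /GRing.scale/=. 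
  by rewrite exprS; ring.
have d1f s' x : partial1of2 f s' x = x ^+ k.+1 * expR (s' * x).
  by rewrite partial1of2E derive_val.
have Is : `](s - 1), (s + 1)[%classic s by rewrite /= in_itv/=; apply/andP;
  split; lra.
have G0 x : 0 <= bound k.+1 s x.
  by rewrite mulr_ge0// addr_ge0 ?expR_ge0.
have Gub x' y : `](s - 1), (s + 1)[%classic x' -> [set: R] y ->
    `|partial1of2 f x' y| <= bound k.+1 s y.
  rewrite /= in_itv/= => /andP[h1 h2] _; rewrite d1f le_bound//.
  by rewrite ler_norml; apply/andP; split; lra.
have intf x' : `](s - 1), (s + 1)[%classic x' ->
    (normal_prob 0 (Num.sqrt v)).-integrable [set: R] (EFin \o f x').
  by move=> _; exact: integrable_normal_prob_expR.
have der x' y : `](s - 1), (s + 1)[%classic x' -> [set: R] y -> derivable (f ^~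
  y) x' 1.
  by [].
have D := derivable_under_integral measurableT Is intf der G0 (integrable_bound
  _ _) Gub.
have E := differentiation_under_integral measurableT Is intf der G0
  (integrable_bound _ _) Gub.
apply: DeriveDef => //; rewrite -derive1E; rewrite [LHS]E.
by apply: eq_Rintegral => x _; exact: d1f.
Qed.

(** If the k-th derivative is q times the moment generating function, the next
    one is (q' + v s q) times it. *)
Lemma gaussian_mgf_step (k : nat) (q q' : R -> R) :
  (forall s : R, is_derive s 1 q (q' s)) ->
  (forall s, gaussian_mgf k s = q s * expR (v * s ^+ 2 / 2)) ->
  forall s, gaussian_mgf k.+1 s = (q' s + v * s * q s) * expR (v * s ^+ 2 / 2).
Proof.
move=> dq Fq s; have := is_derive_gaussian_mgf k s.
rewrite (_ : gaussian_mgf k = (fun s => q s * expR (v * s ^+ 2 / 2)));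
  last exact/funext.
move=> h; rewrite -(derive_val (is_derive := h)).
move: (dq s) => dqs {h}.
suff h : is_derive s 1 (fun s : R => q s * expR (v * s ^+ 2 / 2))
    ((q' s + v * s * q s) * expR (v * s ^+ 2 / 2)).
  by rewrite (derive_val (is_derive := h)).
by apply: is_derive_eq; rewrite /GRing.scale/=; field.
Qed.

Lemma gaussian_mgf0 s : gaussian_mgf 0 s = expR (v * s ^+ 2 / 2).
Proof.
rewrite /gaussian_mgf /Rintegral; under eq_integral do rewrite expr0 mul1r.
by rewrite ge0_integral_normal_prob_expR.
Qed.

Lemma integrable_normal_prob_expn k :
  (normal_prob 0 (Num.sqrt v)).-integrable [set: R] (EFin \o (fun x => x ^+ k)).
Proof.
rewrite (_ : (fun x => x ^+ k) = (fun x => x ^+ k * expR (0 * x))).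
  exact: integrable_normal_prob_expR.
by apply/funext => x; rewrite mul0r expR0 mulr1.
Qed.

(** The moments of the centered Gaussian of variance v up to order four; the
    value is meaningless for larger k. *)
Definition gaussian_moment (k : nat) : R :=
  nth 0 [:: 1; 0; v; 0; 3 * v ^+ 2] k.

Lemma integral_normal_prob_expn k : (k <= 4)%N ->
  \int[normal_prob 0 (Num.sqrt v)]_x (x ^+ k) = gaussian_moment k.
Proof.
pose q0 (s : R) : R := 1; pose q1 (s : R) := v * s.
pose q2 (s : R) := v + v ^+ 2 * s ^+ 2.
pose q3 (s : R) := 3 * v ^+ 2 * s + v ^+ 3 * s ^+ 3.
have F0 s : gaussian_mgf 0 s = q0 s * expR (v * s ^+ 2 / 2).
  by rewrite gaussian_mgf0 mul1r.
have F1 s : gaussian_mgf 1 s = q1 s * expR (v * s ^+ 2 / 2).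
  by rewrite (gaussian_mgf_step (q' := fun=> 0) _ F0)// /q0 /q1;
    congr (_ * _); ring.
have F2 s : gaussian_mgf 2 s = q2 s * expR (v * s ^+ 2 / 2).
  rewrite (gaussian_mgf_step (q' := fun=> v) _ F1); last first.
    by move=> x; apply: is_derive_eq; rewrite /GRing.scale/=; ring.
  by congr (_ * _); rewrite /q1 /q2; ring.
have F3 s : gaussian_mgf 3 s = q3 s * expR (v * s ^+ 2 / 2).
  rewrite (gaussian_mgf_step (q' := fun s => 2 * v ^+ 2 * s) _ F2); last first.
    by move=> x; apply: is_derive_eq; rewrite /GRing.scale/=; ring.
  by congr (_ * _); rewrite /q2 /q3; ring.
have F4 s : gaussian_mgf 4 s =
    (3 * v ^+ 2 + 3 * v ^+ 3 * s ^+ 2 + v * s * q3 s) * expR (v * s ^+ 2 / 2).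
  rewrite (gaussian_mgf_step (q' := fun s => 3 * v ^+ 2 + 3 * v ^+ 3 * s ^+ 2)
    _ F3)//.
  by move=> x; apply: is_derive_eq; rewrite /GRing.scale/=; ring.
have FE : \int[normal_prob 0 (Num.sqrt v)]_x (x ^+ k) = gaussian_mgf k 0.
  by apply: eq_Rintegral => x _; rewrite mul0r expR0 mulr1.
have E0 : expR (v * 0 ^+ 2 / 2) = 1 :> R by rewrite expr0n/= mulr0 mul0r expR0.
rewrite {}FE; case: k => [|[|[|[|[|//]]]]] _; rewrite ?(F0, F1, F2, F3, F4) E0;
  rewrite /gaussian_moment /= /q0 /q1 /q2 /q3; ring.
Qed.

End GaussianMoments.

(** * Products of functions of independent variables *)

Section Independence.
Context d {Om : measurableType d} {R : realType} {P : probability Om R}.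
Context {I : finType} (X : I -> {RV P >-> R}).
Hypothesis X_indep : mutually_independent X.

(* f with its function at index a replaced by g *)
Let update (f : I -> R -> R) a g i := if i == a then g else f i.

Let prod_update (f : I -> R -> R) a g w :
  \prod_i update f a g i (X i w) =
  g (X a w) * \prod_(i | i != a) f i (X i w).
Proof.
rewrite (bigD1 a)//= /update eqxx; congr (_ * _).
by apply: eq_bigr => i /negbTE ->.
Qed.

Let Rprod_update (f : I -> R -> R) a g :
  \prod_i \int[P]_w update f a g i (X i w) =
  (\int[P]_w g (X a w)) * \prod_(i | i != a) \int[P]_w f i (X i w).
Proof.
rewrite (bigD1 a)//= /update eqxx; congr (_ * _).
by apply: eq_bigr => i /negbTE ->.
Qed.

Let measurable_prod_RV (f : I -> R -> R) (Q : pred I) :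
  (forall i, measurable_fun [set: R] (f i)) ->
  measurable_fun [set: Om] (fun w => \prod_(i | Q i) f i (X i w)).
Proof.
move=> mf; under eq_fun do rewrite -big_filter.
by apply: measurable_prod => i _; exact: measurableT_comp.
Qed.

Let integrable_indic_RV (B : set R) i : measurable B ->
  P.-integrable [set: Om] (EFin \o (\1_B \o X i)).
Proof.
move=> mB; apply: (@le_integrable _ _ _ P setT measurableT _ (EFin \o cst 1)).
- apply/measurable_EFinP; apply: measurableT_comp => //;
    exact: measurable_indic.
- by move=> w _ /=; rewrite lee_fin indicE normr1; case: (_ \in _);
    rewrite ?normr1 ?normr0.
- exact: finite_measure_integrable_cst.
Qed.

Let preimage_RV (B : set R) i : measurable B -> measurable (X i @^-1` B).
Proof. by move=> mB; rewrite -[_ @^-1` _]setTI; exact: measurable_funP. Qed.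

Let Rintegral_indic_RV (B : set R) i : measurable B ->
  (\int[P]_w \1_B (X i w))%:E = P (X i @^-1` B).
Proof.
move=> mB; rewrite fineK; last first.
  by apply: integrable_fin_num => //; exact: integrable_indic_RV.
rewrite -[X in _ = P X]setIT -integral_indic//; exact: preimage_RV.
Qed.

Let integral_prod_indic (B : I -> set R) : (forall i, measurable (B i)) ->
  (\int[P]_w (\prod_i \1_(B i) (X i w))%:E)%E =
  (\prod_i \int[P]_w \1_(B i) (X i w))%:E.
Proof.
move=> mB; rewrite -prodEFin.
under [RHS]eq_bigr do rewrite Rintegral_indic_RV//.
have := @X_indep [set: I]%SET B (fun i _ => mB i).
under [X in _ = X -> _]eq_bigl do rewrite inE.
move=> <-; set E := \bigcap_(i in _) _.
have mE : measurable E.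
  by apply: fin_bigcap_measurable => // i _; exact: preimage_RV.
rewrite -[X in _ = P X]setIT -integral_indic//; apply: eq_integral => w _.
congr EFin; rewrite indicE; case: (boolP (w \in E)) => [|wE].
  rewrite inE => wE; apply: big1 => i _; rewrite indicE mem_set//.
  by apply: wE => /=; rewrite inE.
have [i Bi] : exists i, X i w \notin B i.
  apply: contrapT => /forallNP Bw; move: wE; rewrite notin_setE; apply => i _.
  by apply/set_mem/negPn/negP; exact: Bw.
by rewrite (bigD1 i)//= indicE (negbTE Bi) mul0r.
Qed.

(** One factor at a time, indicators are replaced by nonnegative functions:
    for h the product of the other factors, the set function mapping B to the
    expectation of h times the indicator of (X a in B) is a multiple of the law
    of X a. *)
Let integral_prod_ge0 (l : seq I) (f : I -> R -> R) :
  (forall i, measurable_fun [set: R] (f i)) -> (forall i x, 0 <= f i x) ->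
  (forall i, P.-integrable [set: Om] (EFin \o (f i \o X i))) ->
  (forall i, i \notin l -> exists2 B, measurable B & f i = \1_B) ->
  (\int[P]_w (\prod_i f i (X i w))%:E)%E = (\prod_i \int[P]_w f i (X i w))%:E.
Proof.
elim: l f => [|a l IH] f mf f0 intf findic.
  have /choice[B BE] i : exists B, measurable B /\ f i = \1_B.
    by have [//|B mB ->] := findic i; exists B.
  rewrite (_ : f = fun i => \1_(B i)); last by apply/funext => i; case: (BE i).
  by apply: integral_prod_indic => i; case: (BE i).
pose h w := \prod_(i | i != a) f i (X i w).
pose c := \prod_(i | i != a) \int[P]_w f i (X i w).
have c0 : 0 <= c.
  by apply: prodr_ge0 => i _; apply: Rintegral_ge0 => w _; exact: f0.
have h0 w : 0 <= h w by apply: prodr_ge0 => i _; exact: f0.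
have mh : measurable_fun [set: Om] h by exact: measurable_prod_RV.
have lawE B : measurable B -> mscale (NngNum c0) (distribution P (X a)) B =
    (\int[P]_(x in X a @^-1` B) (h x)%:E)%E.
  move=> mB; pose f' := update f a (\1_B).
  have f'E i : f' i = if i == a then \1_B else f i by [].
  have f'E2 := @prod_update f a (\1_B); have Rf' := @Rprod_update f a (\1_B).
  have : (\int[P]_w (\prod_i f' i (X i w))%:E)%E =
      (\prod_i \int[P]_w f' i (X i w))%:E.
    apply: IH => i; rewrite f'E; have [_|ia] := eqVneq i a => //.
    - exact: integrable_indic_RV.
    - by exists B.
    - by move=> il; apply: findic; rewrite inE negb_or ia.
  rewrite Rf' -/c EFinM Rintegral_indic_RV// => f'c.
  rewrite /mscale/= muleC -f'c [in RHS]integral_mkcond.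
  apply: eq_integral => w _; rewrite f'E2 -/(h w) patchE indicE.
  have -> : (w \in X a @^-1` B) = (X a w \in B) by [].
  by case: (_ \in _); rewrite ?mul1r ?mul0r.
have := ge0_integral_density (measurable_funP (X a)) mh h0 lawE (mf a) (f0 a).
rewrite ge0_integral_mscale//; last 2 first.
- exact/measurable_EFinP.
- by move=> x _; rewrite lee_fin.
rewrite ge0_integral_distribution; last 2 first.
- exact/measurable_EFinP.
- by move=> y; rewrite lee_fin.
move=> E; rewrite [in RHS](bigD1 a)//= -/c mulrC EFinM.
rewrite fineK; last exact: integrable_fin_num (intf a).
rewrite [RHS]E; apply: eq_integral => w _.
by rewrite (bigD1 a)//= mulrC.
Qed.

(* The functions indexed by l are now arbitrary; each of them is split into its
   positive and negative parts. *)
Let integral_prod (l : seq I) (f : I -> R -> R) :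
  (forall i, measurable_fun [set: R] (f i)) ->
  (forall i, P.-integrable [set: Om] (EFin \o (f i \o X i))) ->
  (forall i, i \notin l -> forall x, 0 <= f i x) ->
  P.-integrable [set: Om] (EFin \o (fun w => \prod_i f i (X i w))) /\
  \int[P]_w (\prod_i f i (X i w)) = \prod_i \int[P]_w f i (X i w).
Proof.
elim: l f => [|a l IH] f mf intf f0.
  have f0' i x : 0 <= f i x by exact: f0.
  have E : (\int[P]_w (\prod_i f i (X i w))%:E)%E =
      (\prod_i \int[P]_w f i (X i w))%:E.
    by apply: (@integral_prod_ge0 (index_enum I)) => // i;
      rewrite mem_index_enum.
  split; last by rewrite /Rintegral E.
  apply/integrableP; split; first exact/measurable_EFinP/measurable_prod_RV.
  under eq_integral => w _.
    rewrite /= ger0_norm; last by apply: prodr_ge0 => i _.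
    over.
  by rewrite E ltry.
pose fp := update f a ((f a)^\+); pose fn := update f a ((f a)^\-).
have part (g : R -> R) : measurable_fun [set: R] g -> (forall x, 0 <= g x) ->
    P.-integrable [set: Om] (EFin \o (g \o X a)) ->
    P.-integrable [set: Om] (EFin \o (fun w => \prod_i update f a g i (X i w)))
      /\
    \int[P]_w (\prod_i update f a g i (X i w)) =
      \prod_i \int[P]_w update f a g i (X i w).
  move=> mg g0 intg; apply: IH => i; rewrite /update;
    have [ia|ia] := eqVneq i a => //.
  - by rewrite ia.
  - by move=> il; apply: f0; rewrite inE negb_or ia.
have [Ip Ep] := part ((f a)^\+) (measurable_funrpos (mf a)) (fun x =>
  funrpos_ge0 (f a) x)
  (integrable_funrpos measurableT (intf a)).
have [In En] := part ((f a)^\-) (measurable_funrneg (mf a)) (fun x =>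
  funrneg_ge0 (f a) x)
  (integrable_funrneg measurableT (intf a)).
have fE x : f a x = (f a)^\+ x - (f a)^\- x.
  by rewrite -[in LHS](funrposBneg (f a)).
have prodE w : \prod_i f i (X i w) =
    \prod_i update f a ((f a)^\+) i (X i w) - \prod_i update f a ((f a)^\-) i
      (X i w).
  by rewrite !prod_update -mulrBl -fE (bigD1 a).
split.
  apply: eq_integrable (integrableB measurableT Ip In) => // w _.
  by rewrite /= prodE.
under eq_Rintegral do rewrite prodE.
rewrite RintegralB// Ep En !Rprod_update -mulrBl [RHS](bigD1 a)//=;
  congr (_ * _).
rewrite -RintegralB//; last 2 first.
- exact: integrable_funrpos (intf a).
- exact: integrable_funrneg (intf a).
by apply: eq_Rintegral => w _; rewrite -fE.
Qed.

(** Expectations of products of functions of independent variables. *)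
Lemma mutually_independent_Rintegral_prod (f : I -> R -> R) :
  (forall i, measurable_fun [set: R] (f i)) ->
  (forall i, P.-integrable [set: Om] (EFin \o (f i \o X i))) ->
  P.-integrable [set: Om] (EFin \o (fun w => \prod_i f i (X i w))) /\
  \int[P]_w (\prod_i f i (X i w)) = \prod_i \int[P]_w f i (X i w).
Proof.
move=> mf intf; apply: (@integral_prod (index_enum I)) => // i.
by rewrite mem_index_enum.
Qed.

End Independence.

(** * Fourth moments and Gaussian quadratic forms *)

Lemma integrable_Rsum d (T : measurableType d) (R : realType)
    (mu : {measure set T -> \bar R}) (J : finType) (f : J -> T -> R) :
  (forall j, mu.-integrable [set: T] (EFin \o f j)) ->
  mu.-integrable [set: T] (EFin \o (fun w => \sum_j f j w)).
Proof.
move=> intf; have := integrable_sum measurableT (index_enum J) (P := predT)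
  (h := fun j => EFin \o f j) (fun j _ => intf j).
by apply: eq_integrable => // w _; rewrite /= sumEFin.
Qed.

Lemma Rintegral_sum d (T : measurableType d) (R : realType)
    (mu : {measure set T -> \bar R}) (J : finType) (f : J -> T -> R) :
  (forall j, mu.-integrable [set: T] (EFin \o f j)) ->
  \int[mu]_w (\sum_j f j w) = \sum_j \int[mu]_w f j w.
Proof.
move=> intf; rewrite /Rintegral sum_fine; last first.
  by move=> j _; exact: integrable_fin_num (intf j).
congr fine; rewrite -(integral_sum measurableT (f := fun j => EFin \o f j))//.
by apply: eq_integral => w _; rewrite /= sumEFin.
Qed.

Lemma integrable_RZl d (T : measurableType d) (R : realType)
    (mu : {measure set T -> \bar R}) (k : R) (f : T -> R) :
  mu.-integrable [set: T] (EFin \o f) ->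
  mu.-integrable [set: T] (EFin \o (fun w => k * f w)).
Proof.
move=> /(integrableZl measurableT k); apply: eq_integrable => // w _.
Qed.

Section Wick.
Context d {Om : measurableType d} {R : realType} {P : probability Om R}.
Context {I : finType} (X : I -> {RV P >-> R}) (v : R).
Hypothesis v_gt0 : 0 < v.
Hypothesis X_indep : mutually_independent X.
Hypothesis X_gauss : forall i, centered_gaussian v (X i).

(* The law of X i and normal_prob live on two displays of the Borel sets of R;
   the pushforward along the identity moves from one to the other. *)
Let measurable_idR : @measurable_fun _ _ (measurableTypeR R) R setT id.
Proof. by move=> _ B mB; rewrite setTI; exact: mB. Qed.

Let law_eq i (f : R -> \bar R) :
  (\int[distribution P (X i)]_x f x = \int[pushforward
     (normal_prob 0 (Num.sqrt v)) (id : measurableTypeR R -> R)]_x f x)%E.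
Proof.
rewrite (eq_measure_integral (pushforward (normal_prob 0 (Num.sqrt v))
  (id : measurableTypeR R -> R)))// => B mB _.
exact: X_gauss.
Qed.

Let mX k i : measurable_fun [set: Om] (fun w => (X i w) ^+ k).
Proof. by apply: measurable_funX. Qed.

Lemma integrable_gaussian_expn k i :
  P.-integrable [set: Om] (EFin \o (fun w => (X i w) ^+ k)).
Proof.
apply/integrableP; split; first exact/measurable_EFinP.
have /integrableP[_] := integrable_normal_prob_expn v_gt0 k.
have mk : measurable_fun [set: R] (EFin \o (fun x => `|x ^+ k|)).
  by apply/measurable_EFinP/measurableT_comp => //; exact: measurable_funX.
rewrite -(@ge0_integral_distribution _ _ _ _ _ P (X i) (fun x => `|x ^+
  k|%:E))//.
by rewrite law_eq ge0_integral_pushforward.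
Qed.

Lemma Rintegral_gaussian_expn k i : (k <= 4)%N ->
  \int[P]_w (X i w) ^+ k = gaussian_moment v k.
Proof.
move=> k4; rewrite -(integral_normal_prob_expn v_gt0 k4) /Rintegral.
have mk : measurable_fun [set: R] (EFin \o (fun x => x ^+ k)).
  by apply/measurable_EFinP; exact: measurable_funX.
congr fine; rewrite -(@integral_distribution _ _ _ _ _ P (X i) (fun x => (x ^+
  k)%:E))//.
  rewrite law_eq integral_pushforward//.
  exact: integrable_normal_prob_expn.
exact: integrable_gaussian_expn.
Qed.

(* the number of occurrences of i among a, b, c, e *)
Let mult (a b c e i : I) : nat := (i == a) + (i == b) + (i == c) + (i == e).

Let prod_mult (a b c e : I) w :
  \prod_i X i w ^+ mult a b c e i = X a w * X b w * X c w * X e w.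
Proof.
have one j : \prod_i X i w ^+ (i == j) = X j w.
  rewrite (bigD1 j)//= eqxx expr1 big1 ?mulr1// => i /negbTE ->.
  by rewrite expr0.
under eq_bigr do rewrite /mult !exprD.
by rewrite !big_split/= !one.
Qed.

Let prod_moment (a b c e : I) :
  \prod_i gaussian_moment v (mult a b c e i) =
  v ^+ 2 * ((a == b)%:R * (c == e)%:R + (a == c)%:R * (b == e)%:R
            + (a == e)%:R * (b == c)%:R).
Proof.
have zero i : mult a b c e i = 1%N ->
    \prod_i gaussian_moment v (mult a b c e i) = 0.
  by move=> mi; rewrite (bigD1 i)//= mi mul0r.
have pair j k : j != k -> mult a b c e =1 (fun i => (i == j).*2 + (i ==
  k).*2)%N ->
    \prod_i gaussian_moment v (mult a b c e i) = v ^+ 2.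
  move=> jk mE; rewrite (bigD1 j)//= (bigD1 k)/=; last by rewrite eq_sym.
  rewrite !mE !eqxx [k == j]eq_sym (negbTE jk) big1 ?mulr1//.
  by move=> i /andP[/negbTE ij /negbTE ik]; rewrite mE ij ik.
(* Unless the four indices are all equal or match in two pairs, one of them
   occurs exactly once and contributes a vanishing first moment. *)
have [eab|ab] := eqVneq a b; have [ece|ce] := eqVneq c e.
- move: zero pair; rewrite -{}eab -{}ece => _ pair.
  have [eac|ac] := eqVneq a c.
    rewrite -eac (bigD1 a)//= /mult !eqxx big1 => [|i /negbTE ->//].
    by rewrite /gaussian_moment/= ?eqxx/=; ring.
  rewrite (pair a c)//; first by rewrite ?eqxx/=; ring.
  by move=> i; rewrite /mult; do 2 case: (i == _).
- move: zero pair; rewrite -{}eab => zero _.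
  have [eac|ac] := eqVneq a c.
    rewrite (zero e); first by rewrite eac (negbTE ce) ?eqxx/=; ring.
    by rewrite /mult eqxx eac [e == c]eq_sym (negbTE ce).
  rewrite (zero c); first by rewrite ?eqxx/=; ring.
  by rewrite /mult eqxx [c == a]eq_sym (negbTE ac) (negbTE ce).
- move: zero pair; rewrite -{}ece => zero _.
  have [eac|ac] := eqVneq a c.
    rewrite (zero b); first by rewrite -eac [b == a]eq_sym (negbTE ab) ?eqxx/=;
      ring.
    by rewrite /mult eqxx -eac [b == a]eq_sym (negbTE ab).
  rewrite (zero a); first by rewrite ?eqxx/=; ring.
  by rewrite /mult eqxx (negbTE ab) (negbTE ac).
have [eac|ac] := eqVneq a c.
  move: zero pair ce; rewrite -{}eac => zero pair ae.
  rewrite (negbTE ae); have [ebe|be] := eqVneq b e.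
    rewrite (pair a b)//; first by rewrite ?eqxx/=; ring.
    by move=> i; rewrite -ebe /mult; do 2 case: (i == _).
  rewrite (zero b); first by rewrite ?eqxx/=; ring.
  by rewrite /mult eqxx [b == a]eq_sym (negbTE ab) (negbTE be).
have [eae|ae] := eqVneq a e.
  move: zero pair; rewrite -{}eae => zero pair.
  have [ebc|bc] := eqVneq b c.
    rewrite (pair a b)//; first by rewrite ?eqxx/=; ring.
    by move=> i; rewrite -ebc /mult; do 2 case: (i == _).
  rewrite (zero b); first by rewrite ?eqxx/=; ring.
  by rewrite /mult eqxx [b == a]eq_sym (negbTE ab) (negbTE bc).
rewrite (zero a); first by rewrite ?eqxx/=; ring.
by rewrite /mult eqxx (negbTE ab) (negbTE ac) (negbTE ae).
Qed.

(** The fourth moment formula (Isserlis, Wick) for independent centered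
    Gaussians of variance v. *)
Lemma gaussian_wick4 a b c e :
  P.-integrable [set: Om]
    (EFin \o (fun w => X a w * X b w * X c w * X e w)) /\
  \int[P]_w (X a w * X b w * X c w * X e w) =
  v ^+ 2 * ((a == b)%:R * (c == e)%:R + (a == c)%:R * (b == e)%:R
            + (a == e)%:R * (b == c)%:R).
Proof.
rewrite -prod_moment.
have mf i : measurable_fun [set: R] (fun x => x ^+ mult a b c e i).
  exact: measurable_funX.
have [intp Ep] := mutually_independent_Rintegral_prod X_indep
  mf
  (fun i => integrable_gaussian_expn (mult a b c e i) i).
split.
  by under eq_fun do rewrite /= -prod_mult.
under eq_Rintegral do rewrite -prod_mult.
rewrite Ep; apply: eq_bigr => i _; apply: Rintegral_gaussian_expn.
by rewrite /mult; do 4 case: (i == _).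
Qed.

(** The second moment of a quadratic form in independent centered Gaussians. *)
Lemma gaussian_quadratic_form (M : I -> I -> R) :
  P.-integrable [set: Om]
    (EFin \o (fun w => (\sum_p \sum_q M p q * (X p w * X q w)) ^+ 2)) /\
  \int[P]_w ((\sum_p \sum_q M p q * (X p w * X q w)) ^+ 2) =
  v ^+ 2 * ((\sum_p M p p) ^+ 2 + \sum_p \sum_q M p q ^+ 2
            + \sum_p \sum_q M p q * M q p).
Proof.
pose f (u : (I * I) * (I * I)) w := M u.1.1 u.1.2 * M u.2.1 u.2.2 *
  (X u.1.1 w * X u.1.2 w * X u.2.1 w * X u.2.2 w).
have QE w : (\sum_p \sum_q M p q * (X p w * X q w)) ^+ 2 = \sum_u f u w.
  rewrite pair_bigA/= expr2 big_distrlr/= pair_bigA/=.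
  by apply: eq_bigr => u _; rewrite /f; ring.
have intf u : P.-integrable [set: Om] (EFin \o f u).
  by apply: integrable_RZl; case: (gaussian_wick4 u.1.1 u.1.2 u.2.1 u.2.2).
split.
  have := integrable_Rsum intf.
  by apply: eq_integrable => // w _ /=; rewrite QE.
under eq_Rintegral do rewrite QE.
rewrite Rintegral_sum//.
have fE u : \int[P]_w f u w = v ^+ 2 * (
    M u.1.1 u.1.2 * M u.2.1 u.2.2 * ((u.1.1 == u.1.2)%:R * (u.2.1 == u.2.2)%:R)
  + M u.1.1 u.1.2 * M u.2.1 u.2.2 * ((u.1.1 == u.2.1)%:R * (u.1.2 == u.2.2)%:R)
  + M u.1.1 u.1.2 * M u.2.1 u.2.2 * ((u.1.1 == u.2.2)%:R * (u.1.2 ==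
    u.2.1)%:R)).
  have [intp Ep] := gaussian_wick4 u.1.1 u.1.2 u.2.1 u.2.2.
  by rewrite /f RintegralZl// Ep; ring.
under eq_bigr do rewrite fE.
rewrite -mulr_sumr; congr (_ * _).
rewrite !big_split/=.
have pick (g : I -> R) p : \sum_q g q * (p == q)%:R = g p.
  rewrite (bigD1 p)//= eqxx mulr1 big1 ?addr0// => q /negbTE.
  by rewrite eq_sym => ->; rewrite mulr0.
congr (_ + _ + _).
- rewrite -(pair_bigA _ (fun u u' => M u.1 u.2 * M u'.1 u'.2 *
     ((u.1 == u.2)%:R * (u'.1 == u'.2)%:R)))/=.
  rewrite expr2 big_distrlr/= -(pair_bigA _ (fun p q => \sum_u' M p q * M u'.1
    u'.2 *
     ((p == q)%:R * (u'.1 == u'.2)%:R)))/=.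
  apply: eq_bigr => p _.
  rewrite -[RHS](pick (fun q => \sum_p' M p q * M p' p'));
    apply: eq_bigr => q _.
  rewrite mulr_suml -(pair_bigA _ (fun p' q' => M p q * M p' q' *
     ((p == q)%:R * (p' == q')%:R)))/=; apply: eq_bigr => p' _.
  rewrite -[RHS](pick (fun q' => M p q * M p' q' * (p == q)%:R)).
  by apply: eq_bigr => q' _; ring.
- rewrite -(pair_bigA _ (fun u u' => M u.1 u.2 * M u'.1 u'.2 *
     ((u.1 == u'.1)%:R * (u.2 == u'.2)%:R)))/= [RHS]pair_bigA/=.
  apply: eq_bigr => -[p q] _ /=.
  rewrite -(pair_bigA _ (fun p' q' => M p q * M p' q' *
     ((p == p')%:R * (q == q')%:R)))/=.
  rewrite -[RHS](pick (fun p' => M p q * M p' q)); apply: eq_bigr => p' _.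
  rewrite -[RHS](pick (fun q' => M p q * M p' q' * (p == p')%:R)).
  by apply: eq_bigr => q' _; ring.
- rewrite -(pair_bigA _ (fun u u' => M u.1 u.2 * M u'.1 u'.2 *
     ((u.1 == u'.2)%:R * (u.2 == u'.1)%:R)))/= [RHS]pair_bigA/=.
  apply: eq_bigr => -[p q] _ /=.
  rewrite -(pair_bigA _ (fun p' q' => M p q * M p' q' *
     ((p == q')%:R * (q == p')%:R)))/=.
  rewrite -[RHS](pick (fun p' => M p q * M p' p)); apply: eq_bigr => p' _.
  rewrite -[RHS](pick (fun q' => M p q * M p' q' * (q == p')%:R)).
  by apply: eq_bigr => q' _; ring.
Qed.

End Wick.

(** * Second moments of a Gaussian sketch *)

Section GaussianSketch.
Context d {Om : measurableType d} {R : realType} {P : probability Om R}.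
Context {t n : nat} (G : 'I_t -> 'I_n -> {RV P >-> R}).
Hypothesis t_gt0 : (0 < t)%N.
Hypothesis G_gauss : gaussian_iid (t%:R^-1) G.

Let t_neq0 : t%:R != 0 :> R.
Proof. by rewrite pnatr_eq0 -lt0n. Qed.

(** For fixed vectors e and u, the entry e^T G^T G u is a quadratic form in the
    entries of G. *)
Lemma sketched_dot_second_moment (e u : 'cV[R]_n)
    (dot := fun w =>
       ((random_matrix G w *m e)^T *m (random_matrix G w *m u)) 0 0) :
  P.-integrable [set: Om] (EFin \o (fun w => dot w ^+ 2)) /\
  \int[P]_w (dot w ^+ 2) = (e^T *m u) 0 0 ^+ 2 +
    (frobenius e ^+ 2 * frobenius u ^+ 2 + (e^T *m u) 0 0 ^+ 2) / t%:R.
Proof.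
pose M (p q : 'I_t * 'I_n) : R := (p.1 == q.1)%:R * (e p.2 0 * u q.2 0).
have v_gt0 : 0 < t%:R^-1 :> R by rewrite invr_gt0 ltr0n.
have [G_indep G_law] := G_gauss.
pose X (ij : 'I_t * 'I_n) : {RV P >-> R} := G ij.1 ij.2.
have X_law ij : centered_gaussian (t%:R^-1) (X ij) by exact: G_law.
have [intQ EQ] := gaussian_quadratic_form v_gt0 G_indep X_law M.
have pick (g : 'I_t -> R) i : \sum_k (i == k)%:R * g k = g i.
  rewrite (bigD1 i)//= eqxx mul1r big1 ?addr0// => k /negbTE.
  by rewrite eq_sym => ->; rewrite mul0r.
have dotE w : dot w = \sum_p \sum_q M p q * (X p w * X q w).
  transitivity (\sum_i (\sum_j G i j w * e j 0) * (\sum_k G i k w * u k 0)).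
    rewrite /dot mxE; apply: eq_bigr => i _; rewrite !mxE.
    by congr (_ * _); apply: eq_bigr => j _; rewrite !mxE.
  rewrite -(pair_bigA _ (fun i j => \sum_q M (i, j) q * (X (i, j) w * X q
    w)))/=.
  apply: eq_bigr => i _; rewrite big_distrlr/=; apply: eq_bigr => j _.
  rewrite -(pair_bigA _ (fun i' k => M (i, j) (i', k) * (X (i, j) w * X (i', k)
    w)))/=.
  rewrite exchange_big/=; apply: eq_bigr => k _.
  rewrite -[LHS](pick (fun i' => G i j w * e j 0 * (G i' k w * u k 0))).
  by apply: eq_bigr => i' _; rewrite /M/=; ring.
split; first by apply: eq_integrable intQ => // w _ /=; rewrite dotE.
under eq_Rintegral do rewrite dotE.
rewrite EQ.
have euE : (e^T *m u) 0 0 = \sum_j e j 0 * u j 0.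
  by rewrite mxE; apply: eq_bigr => j _; rewrite mxE.
have trM : \sum_p M p p = t%:R * (e^T *m u) 0 0.
  rewrite -(pair_bigA _ (fun i j => M (i, j) (i, j)))/=.
  under eq_bigr => i _ do under eq_bigr => j _ do rewrite /M/= eqxx mul1r.
  by rewrite sumr_const card_ord euE mulr_natl.
have double (g : 'I_n -> 'I_n -> R) :
    \sum_(p : 'I_t * 'I_n) \sum_(q : 'I_t * 'I_n) (p.1 == q.1)%:R * g p.2 q.2 =
    t%:R * \sum_j \sum_k g j k.
  rewrite -(pair_bigA _ (fun i j => \sum_(q : 'I_t * 'I_n) (i == q.1)%:R * g j
    q.2))/=.
  transitivity (\sum_(i < t) \sum_j \sum_k g j k).
    apply: eq_bigr => i _; apply: eq_bigr => j _.
    rewrite -(pair_bigA _ (fun i' k => (i == i')%:R * g j k))/= exchange_big/=.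
    by apply: eq_bigr => k _; rewrite pick.
  by rewrite sumr_const card_ord mulr_natl.
have M2 : \sum_p \sum_q M p q ^+ 2 = t%:R * (frobenius e ^+ 2 * frobenius u ^+
  2).
  have sqrE (x : 'cV[R]_n) : frobenius x ^+ 2 = \sum_j x j 0 ^+ 2.
    by rewrite frobenius_sqrE; apply: eq_bigr => j _; rewrite big_ord1.
  rewrite !sqrE big_distrlr/= -double; apply: eq_bigr => p _;
    apply: eq_bigr => q _.
  by rewrite /M; case: (_ == _) => /=; ring.
have MM : \sum_p \sum_q M p q * M q p = t%:R * (e^T *m u) 0 0 ^+ 2.
  rewrite euE expr2 big_distrlr/= -double.
  apply: eq_bigr => p _; apply: eq_bigr => q _.
  by rewrite /M [q.1 == _]eq_sym; case: (_ == _) => /=; ring.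
rewrite trM M2 MM; field.
exact: t_neq0.
Qed.

(** The second moment of U^T G^T G x: the r coordinates each contribute
    |x|^2 / t, and the part of x in the range of U the rest. *)
Lemma sketched_projection_second_moment r (U : 'M[R]_(n, r)) (x : 'cV[R]_n)
    (f := fun w =>
       frobenius (((random_matrix G w)^T *m random_matrix G w *m U)^T *m x)
         ^+ 2) :
  U^T *m U = 1%:M ->
  P.-integrable [set: Om] (EFin \o f) /\
  \int[P]_w f w <= (1 + r.+1%:R / t%:R) * frobenius x ^+ 2.
Proof.
move=> UU.
pose g k w :=
  ((random_matrix G w *m col k U)^T *m (random_matrix G w *m x)) 0 0 ^+ 2.
have fE w : f w = \sum_k g k w.
  rewrite /f frobenius_sqrE; apply: eq_bigr => k _; rewrite big_ord1;
    congr (_ ^+ 2).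
  rewrite -col_mulmx tr_col -row_mul [RHS]mxE; congr (fun_of_matrix _ _ _).
  by rewrite !trmx_mul trmxK !mulmxA.
have intg k : P.-integrable [set: Om] (EFin \o g k).
  by case: (sketched_dot_second_moment (col k U) x).
split.
  by apply: eq_integrable (integrable_Rsum intg) => // w _ /=; rewrite fE.
under eq_Rintegral do rewrite fE.
rewrite Rintegral_sum//.
have gE k : \int[P]_w g k w = ((col k U)^T *m x) 0 0 ^+ 2 * (1 + t%:R^-1)
    + frobenius x ^+ 2 / t%:R.
  have [_ ->] := sketched_dot_second_moment (col k U) x.
  rewrite (@frobenius_col_gram_diag _ _ _ _ (fun=> 1))// ?UU; first by ring.
  by apply/matrixP => i j; rewrite !mxE expr1n.
under eq_bigr do rewrite gE.
rewrite big_split/= -mulr_suml sumr_const card_ord -mulr_natl.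
have -> : \sum_k ((col k U)^T *m x) 0 0 ^+ 2 = frobenius (U^T *m x) ^+ 2.
  rewrite frobenius_sqrE; apply: eq_bigr => k _; rewrite big_ord1.
  by rewrite tr_col -row_mul [X in X ^+ 2]mxE.
have : frobenius (U^T *m x) ^+ 2 <= frobenius x ^+ 2.
  by rewrite ler_pXn2r ?nnegrE ?frobenius_ge0// orthonormal_tr_contraction.
have t0 : 0 <= t%:R^-1 :> R by rewrite invr_ge0.
rewrite -natr1; nra.
Qed.

End GaussianSketch.

(** * Events of large probability *)

Section WithProb.
Context d {Om : measurableType d} {R : realType} (P : probability Om R).

Lemma with_prob_geT (p : R) (Q : set Om) :
  p <= 1 -> (forall w, Q w) -> with_prob_ge P p Q.
Proof.
by move=> p1 QT; exists setT; split => //; rewrite probability_setT lee_fin.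
Qed.

Lemma with_prob_geS (p q : R) (Q Q' : set Om) :
  q <= p -> Q `<=` Q' -> with_prob_ge P p Q -> with_prob_ge P q Q'.
Proof.
move=> qp QQ' [E [mE EQ pE]]; exists E; split => //;
  first exact: subset_trans EQ QQ'.
by apply: le_trans pE; rewrite lee_fin.
Qed.

(** The union bound. *)
Lemma with_prob_geI (p q : R) (Q Q' : set Om) :
  with_prob_ge P (1 - p) Q -> with_prob_ge P (1 - q) Q' ->
  with_prob_ge P (1 - (p + q)) (Q `&` Q').
Proof.
move=> [E [mE EQ pE]] [E' [mE' EQ' qE']]; exists (E `&` E'); split.
- exact: measurableI.
- exact: setISS.
have compl (F : set Om) : measurable F -> P F = (1 - fine (P (~` F)))%:E.
  move=> mF; have := probability_setC P (measurableC mF).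
  rewrite setCK => ->; rewrite EFinB fineK//.
  by apply: fin_num_measure; exact: measurableC.
move: pE qE'; rewrite (compl _ mE) (compl _ mE') (compl _ (measurableI _ _ mE
  mE')).
rewrite !lee_fin setCI.
have mC := measurableC mE; have mC' := measurableC mE'.
have : fine (P (~` E `|` ~` E')) <= fine (P (~` E)) + fine (P (~` E')).
  rewrite -fineD ?fin_num_measure//; apply: fine_le.
  - by apply: fin_num_measure; exact: measurableU.
  - by rewrite fin_numD !fin_num_measure.
  - exact: measureU2.
lra.
Qed.

Lemma with_prob_ge_markov (Z : Om -> R) (c : R) :
  0 < c -> (forall w, 0 <= Z w) -> P.-integrable [set: Om] (EFin \o Z) ->
  with_prob_ge P (1 - (\int[P]_w Z w) / c) [set w | Z w <= c].
Proof.
move=> c0 Z0 intZ; have mZ : measurable_fun [set: Om] Z.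
  by apply/measurable_EFinP; exact: measurable_int intZ.
have mE : measurable [set w | Z w <= c].
  by rewrite -[X in measurable X]setTI; exact: measurable_fun_le.
have mEC := measurableC mE.
exists [set w | Z w <= c]; split => //.
have -> : P [set w | Z w <= c] = (1 - fine (P (~` [set w | Z w <= c])))%:E.
  have := probability_setC P mEC; rewrite setCK => ->.
  by rewrite EFinB fineK// fin_num_measure.
rewrite lee_fin lerD2l lerN2 ler_pdivlMr//.
set E := ~` _ in mEC *.
have : ((fine (P E) * c)%:E <= \int[P]_w (Z w)%:E)%E.
  rewrite EFinM fineK ?fin_num_measure// muleC -integral_cst//.
  apply: (@le_trans _ _ (\int[P]_(w in E) (Z w)%:E)%E).
    apply: ge0_le_integral => //.
    - by move=> w _; rewrite lee_fin ltW.
    - exact/measurable_funTS/measurable_EFinP.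
    - by move=> w /negP; rewrite lee_fin -ltNge => /ltW.
  apply: ge0_subset_integral => //; first exact/measurable_EFinP.
  by move=> w _; rewrite lee_fin.
have Zfin : (\int[P]_w (Z w)%:E)%E \is a fin_num by exact: integrable_fin_num
  intZ.
by rewrite -[X in (_ <= X)%E](fineK Zfin) lee_fin.
Qed.

End WithProb.

(** * The error bound *)

Lemma c1_lower_bound (R : realType) (r t : nat) : (0 < r < t)%N ->
  1 + r.+1%:R / t%:R <= c1 r t :> R.
Proof.
move=> /andP[r0 rt]; have t0 : (0 < t)%N by exact: ltn_trans rt.
have tR : 0 < t%:R :> R by rewrite ltr0n.
have a0 : 0 <= r%:R / t%:R :> R by rewrite divr_ge0.
have a1 : r%:R / t%:R <= 1 :> R by rewrite ler_pdivrMr// mul1r ler_nat ltnW.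
rewrite /c1; set b := Num.sqrt (r%:R / t%:R).
have b0 : 0 <= b by exact: sqrtr_ge0.
have bb : b ^+ 2 = r%:R / t%:R by rewrite sqr_sqrtr.
have b1 : b <= 1 by rewrite -(@ler_pXn2r _ 2) ?nnegrE// bb expr1n.
have t1 : t%:R^-1 <= b ^+ 2 :> R.
  by rewrite bb ler_peMl ?invr_ge0// ler1n.
have sqrt1 (x : R) : 0 <= x -> 1 <= Num.sqrt (1 + x).
  by move=> x0; rewrite -[leLHS]sqrtr1 ler_wsqrtr// lerDl.
have h1 := sqrt1 _ (sqrtr_ge0 (2 / r%:R)).
have h2 : 1 <= Num.sqrt (1 + 2 / t%:R) :> R by apply: sqrt1; rewrite divr_ge0.
apply: (@le_trans _ _ ((1 + b) ^+ 2)).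
  by rewrite -natr1 mulrDl mul1r -bb; nra.
have h3 : 0 <= (1 + b) ^+ 2 by exact: sqr_ge0.
rewrite -mulrA ler_peMr//.
by rewrite -[leLHS]mulr1 ler_pM.
Qed.

Theorem theorem4p5 (R : realType) (d : measure_display) (Om : measurableType d)
    (P : probability Om R) (n r t : nat)
    (A : 'M[R]_n) (C : 'M[R]_(n, r)) (eps delta Delta : R)
    (G : 'I_t -> 'I_n -> {RV P >-> R})
    (Mstar : 'M[R]_r) (Mhat : Om -> 'M[R]_r)
    (A_sym : A^T = A)
    (C_cols : column_subset A C)
    (le_rn : (r <= n)%N)
    (C_full : \rank C = r)
    (lt_rt : (r < t)%N)
    (t_multiple : exists a : R, t%:R = a * r%:R)
    (eps_gt0 : 0 < eps) (eps_lt1 : eps < 1) (delta_ge0 : 0 <= delta)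
    (G_gauss : gaussian_iid (t%:R^-1) G)
    (G_ose : oblivious_subspace_embedding P r eps delta (random_matrix G))
    (Mstar_argmin : is_argmin
      (fun M : 'M[R]_r => frobenius (A - C *m M *m C^T) ^+ 2) Mstar)
    (Mhat_argmin : forall w : Om, is_argmin
      (fun M : 'M[R]_r =>
         frobenius (random_matrix G w *m (A - C *m M *m C^T)
                    *m (random_matrix G w)^T) ^+ 2) (Mhat w))
    (Delta_gt : c1 r t * Num.sqrt r%:R < Delta) :
  with_prob_ge P (1 - (c1 r t * Num.sqrt r%:R / Delta + delta))
    [set w | nuclear_norm (A - C *m Mhat w *m C^T) <=
             (1 + c2 r eps Delta * Num.sqrt r%:R)
             * nuclear_norm (A - C *m Mstar *m C^T)].
Proof.
have Delta0 : 0 < Delta.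
  apply: le_lt_trans Delta_gt; rewrite mulr_ge0 ?sqrtr_ge0//.
  by rewrite /c1 !mulr_ge0 ?sqrtr_ge0 ?sqr_ge0.
(* For r = 0 both approximants vanish and the claim is an equality. *)
have [r0|r0] := posnP r.
  apply: with_prob_geT => [|w].
    by rewrite r0 sqrtr0 mulr0 mul0r add0r; lra.
  have CMC M : C *m M *m C^T = 0.
    move: C M {C_cols C_full G_ose Mstar_argmin Mhat_argmin Mstar Mhat}.
    by rewrite r0 => C M; rewrite [C *m M]thinmx0 mul0mx.
  have sr0 : Num.sqrt r%:R = 0 :> R by rewrite r0 sqrtr0.
  by rewrite /= !CMC sr0 mulr0 addr0 mul1r.
have t0 : (0 < t)%N by exact: leq_trans lt_rt.
have [U [T [CE UU Tu]]] := orthonormal_factorization C_full.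
set X0 := A - C *m Mstar *m C^T.
have [V [s [VV s0 XV nuE]]] := right_singular_basis X0.
have sE k : frobenius (X0 *m col k V) = s k.
  by rewrite -col_mulmx (frobenius_col_gram_diag (s0 k) XV).
have V1 k : frobenius (col k V) = 1.
  rewrite (@frobenius_col_gram_diag _ _ _ _ (fun=> 1))// VV.
  by apply/matrixP => i j; rewrite !mxE expr1n.
(* Z bounds the Frobenius norm of Y^T X0 Y and, unlike it, is a polynomial in
   the entries of G.  When s k = 0, z k vanishes because 0^-1 = 0, and it is
   still a bound because X0 maps col k V to 0. *)
pose Y w := (random_matrix G w)^T *m random_matrix G w *m U.
pose f (x : 'cV[R]_n) w := frobenius ((Y w)^T *m x) ^+ 2.
have intf x := (sketched_projection_second_moment t0 G_gauss x UU).1.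
have Ef x := (sketched_projection_second_moment t0 G_gauss x UU).2.
set K := 1 + _ in Ef.
pose z k w :=
  2^-1 * (s k)^-1 * f (X0 *m col k V) w + 2^-1 * s k * f (col k V) w.
pose Z w := \sum_k z k w.
have f0 x w : 0 <= f x w by exact: sqr_ge0.
have z0 k w : 0 <= z k w.
  by apply: addr_ge0; apply: mulr_ge0 => //; apply: mulr_ge0; rewrite ?invr_ge0.
have intz k : P.-integrable [set: Om] (EFin \o z k).
  have := integrableD measurableT
    (integrable_RZl (2^-1 * (s k)^-1) (intf (X0 *m col k V)))
    (integrable_RZl (2^-1 * s k) (intf (col k V))).
  by apply: eq_integrable => // w _.
have Ez k : \int[P]_w z k w <= K * s k.
  rewrite RintegralD//; [|by apply: integrable_RZl; exact: intf..].
  rewrite !RintegralZl//; [|exact: intf..].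
  have h1 := Ef (X0 *m col k V); have h2 := Ef (col k V).
  rewrite sE in h1; rewrite V1 expr1n mulr1 in h2.
  apply: (@le_trans _ _ (2^-1 * (s k)^-1 * (K * s k ^+ 2) + 2^-1 * s k * K)).
    by apply: lerD; apply: ler_wpM2l => //; rewrite mulr_ge0 ?invr_ge0.
  have [->|sk] := eqVneq (s k) 0; first by rewrite invr0 !(mulr0, mul0r) addr0.
  by rewrite le_eqVlt; apply/orP; left; apply/eqP; field.
have intZ : P.-integrable [set: Om] (EFin \o Z) by exact: integrable_Rsum.
have EZ : \int[P]_w Z w <= K * nuclear_norm X0.
  by rewrite (Rintegral_sum intz) nuE mulr_sumr; apply: ler_sum => k _;
    exact: Ez.
have Z0 w : 0 <= Z w by exact: sumr_ge0.
have FZ w : frobenius ((Y w)^T *m X0 *m Y w) <= Z w.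
  apply: (le_trans (frobenius_congruence_le _ _ VV)); apply: ler_sum => k _.
  rewrite /z /f; set a := frobenius _; set b := frobenius _.
  have [sk|sk] := eqVneq (s k) 0.
    have -> : a = 0.
      by rewrite /a (frobenius_eq0 (etrans (sE k) sk)) mulmx0 frobenius0.
    by rewrite mul0r expr0n/= sk !mulr0 mul0r addr0.
  have sk0 : 0 < s k by rewrite lt_def sk s0.
  rewrite -subr_ge0.
  have -> : 2^-1 * (s k)^-1 * a ^+ 2 + 2^-1 * s k * b ^+ 2 - a * b =
    2^-1 * (s k)^-1 * (a - s k * b) ^+ 2 by field.
  by rewrite mulr_ge0 ?sqr_ge0// mulr_ge0 ?invr_ge0.
have nu0 : 0 <= nuclear_norm X0 by rewrite nuE sumr_ge0.
have rR : 0 < Num.sqrt r%:R :> R by rewrite sqrtr_gt0 ltr0n.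
have Kc1 : K <= c1 r t by apply: c1_lower_bound; rewrite r0.
(* Chosen so that sqrt r * thr / (1 - eps)^2 is the error term of the claim. *)
pose thr := Delta * nuclear_norm X0 / Num.sqrt r%:R.
have ZP : with_prob_ge P (1 - c1 r t * Num.sqrt r%:R / Delta)
    [set w | Z w <= thr].
  (* Markov's inequality needs a positive threshold; if X0 has nuclear norm 0
     then Z is identically 0. *)
  have [nu1|nu1] := eqVneq (nuclear_norm X0) 0.
    apply: with_prob_geT => [|w].
      by rewrite gerBl divr_ge0 ?mulr_ge0 ?(ltW rR) ?(ltW Delta0)//
        (le_trans _ Kc1)// addr_ge0// divr_ge0.
    have sk k : s k = 0.
      apply/eqP; move: nu1; rewrite nuE => /eqP.
      by rewrite psumr_eq0// => /allP/(_ k (mem_index_enum _)).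
    rewrite /thr nu1 mulr0 mul0r /= /Z big1// => k _.
    by rewrite /z sk invr0 !mulr0 !mul0r addr0.
  have nu2 : 0 < nuclear_norm X0 by rewrite lt_def nu1.
  have thr0 : 0 < thr by rewrite divr_gt0// mulr_gt0.
  apply: with_prob_geS (with_prob_ge_markov thr0 Z0 intZ) => //.
  rewrite lerD2l lerN2 ler_pdivrMr//.
  have -> : c1 r t * Num.sqrt r%:R / Delta * thr = c1 r t * nuclear_norm X0.
    by rewrite /thr; field; rewrite !gt_eqF.
  by rewrite (le_trans EZ)// ler_wpM2r.
apply: (with_prob_geS _ _ (with_prob_geI ZP (G_ose U))) => // w [/= Zw Uw].
have e0 : 0 < 1 - eps by rewrite subr_gt0.
have := Mhat_argmin w; rewrite CE => Mmin.
have Uw' (x : 'cV[R]_r) : (1 - eps) * frobenius (U *m x) ^+ 2 <=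
    frobenius (random_matrix G w *m U *m x) ^+ 2.
  by have [] := Uw x; rewrite !l2norm_frobenius.
have := sketched_residual_bound Mstar UU Tu e0 Uw' Mmin.
rewrite -CE -/X0 => /le_trans; apply.
rewrite mulrDl mul1r lerD2l -/(Y w).
have -> : c2 r eps Delta * Num.sqrt r%:R * nuclear_norm X0 =
    Num.sqrt r%:R * (thr / (1 - eps) ^+ 2).
  rewrite /c2 /thr; field; rewrite gt_eqF//=; exact: lt0r_neq0.
rewrite ler_pM2l// ler_pM2r ?invr_gt0 ?exprn_gt0//.
exact: le_trans (FZ w) Zw.
Qed.
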